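(* Let $(A,\mathcal{D})$ be a digit system with $b\geqslant2$, and let $\mathcal{F}=\mathcal{F}(A,\mathcal{D})$ be a rational self-affine tile, i.e. $\mu(\mathcal{F})>0$. Then $\mathcal{F}+\varphi(\mathbb{Z}^n[A])$ is a multiple tiling of $\mathbb{K}_A$.
   Context: Let $n\geqslant 1$ and let $A\in\mathbb{Q}^{n\times n}$ be expanding (all eigenvalues have absolute value $>1$); put $B:=A^{-1}$. For an invertible $M\in\mathbb{Q}^{n\times n}$ let $\mathbb{Z}^n[M]:=\bigcup_{k\geqslant 1}(\mathbb{Z}^n+M\mathbb{Z}^n+\dots+M^{k-1}\mathbb{Z}^n)$. Put $a:=|\mathbb{Z}^n[A]/A\mathbb{Z}^n[A]|$ and $b:=|\mathbb{Z}^n[B]/B\mathbb{Z}^n[B]|$ (both finite). Representation space: let $\mathbb{Z}^n(B):=\bigcup_{k\geqslant 1}(B^{-k}\mathbb{Z}^n+B^{-k+1}\mathbb{Z}^n+\dots+B^k\mathbb{Z}^n)$. For $y\in\mathbb{Z}^n(B)$ let $\nu(y):=\inf\{k\in\mathbb{Z} : y\notin B^{k+1}\mathbb{Z}^n[B]\}\in\mathbb{Z}\cup\{\infty\}$ (with $\inf\varnothing=\infty$), and ${\bf d}_B(y,y'):=b^{-\nu(y-y')}$, with $b^{-\infty}=0$. $\mathbb{Z}^n((B))$ is the completion of $\mathbb{Z}^n(B)$ with respect to ${\bf d}_B$ (points at distance $0$ being identified); the group structure, $\nu$, ${\bf d}_B$ and multiplication by $A$ and $B$ extend to it, and elements of $\mathbb{Z}^n(B)$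 are regarded as elements of $\mathbb{Z}^n((B))$ via the canonical map. $\mathbb{Z}^n[[B]]:=\{y\in\mathbb{Z}^n((B)):\nu(y)\geqslant 0\}$, and $\mu_B$ is the Haar measure on $\mathbb{Z}^n((B))$ with $\mu_B(\mathbb{Z}^n[[B]])=1$. Let $\mathbb{K}_A:=\mathbb{R}^n\times\mathbb{Z}^n((B))$, with metric ${\bf d}((x,y),(x',y')):=\max\{\|x-x'\|,{\bf d}_B(y,y')\}$ ($\|\cdot\|$ Euclidean) and Haar measure $\mu:=\lambda\times\mu_B$, $\lambda$ being Lebesgue measure. $A$ acts by $A(x,y)=(Ax,Ay)$. Let $\varphi:\mathbb{Z}^n(B)\to\mathbb{K}_A$, $\varphi(x)=(x,x)$. A digit system is a pair $(A,\mathcal{D})$ with $A\in\mathbb{Q}^{n\times n}$ expanding and $\mathcal{D}\subset\mathbb{Z}^n[A]$, $|\mathcal{D}|=a$. $\mathcal{F}(A,\mathcal{D})\subset\mathbb{K}_A$ is the unique nonempty compact set with $A\mathcal{F}=\bigcup_{d\in\mathcal{D}}(\mathcal{F}+\varphi(d))$; explicitly $\mathcal{F}=\{\sum_{j\geqslant1}A^{-j}\varphi(d_j): d_j\in\mathcal{D}\}$. For $\mathcal{S}\subset\mathbb{K}_A$, the collection $\mathcal{F}+\mathcal{S}:=\{\mathcal{F}+s:s\in\mathcal{S}\}$ is a multiple tiling of $\mathbb{K}_A$ if there exists an integer $k\geqslant1$ such that $\mu$-almost every point of $\mathbb{K}_A$ is contained in exactly $k$ distinct sets of the form $\mathcal{F}+s$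 with $s\in\mathcal{S}$. *)

(* Defs.v *)
From HB Require Import structures.
From mathcomp Require Import all_boot all_order all_algebra all_field.
From mathcomp Require Import finmap zify.
From mathcomp Require Import all_classical all_reals all_analysis.
Set Implicit Arguments.
Unset Strict Implicit.
Unset Printing Implicit Defensive.
Import Order.TTheory GRing.Theory Num.Theory.
Import numFieldNormedType.Exports.
Local Open Scope classical_set_scope.
Local Open Scope ring_scope.
Local Open Scope quotient_scope.

Record inv_pseudometric (R : realType) (V : zmodType) := InvPseudometric {
  ipm_dist :> V -> V -> R ;
  ipm_distxx : forall x, ipm_dist x x = 0 ;
  ipm_sym : forall x y, ipm_dist x y = ipm_dist y x ;
  ipm_triangle : forall y x z, ipm_dist x z <= ipm_dist x y + ipm_dist y z ;
  ipm_invariant : forall x y z, ipm_dist (x + z) (y + z) = ipm_dist x y }.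

Section CauchySequences.
Variables (R : realType) (V : zmodType) (d : inv_pseudometric R V).
Implicit Types (u v w : nat -> V).

Lemma ipm_ge0 (x y : V) : 0 <= d x y.
Proof.
have := ipm_triangle d y x x.
by rewrite ipm_distxx (ipm_sym d y x) -mulr2n pmulrn_lge0.
Qed.

Lemma ipm_opp (x y : V) : d (- x) (- y) = d x y.
Proof.
rewrite -(ipm_invariant d (- x) (- y) (x + y)) addrA addNr add0r.
by rewrite [x + y]addrC addrA addNr add0r ipm_sym.
Qed.

Lemma ipm_add (x y x' y' : V) : d (x + y) (x' + y') <= d x x' + d y y'.
Proof.
apply: le_trans (ipm_triangle d (x' + y) _ _) _.
by rewrite ipm_invariant ![x' + _]addrC ipm_invariant.
Qed.

Definition cauchy_seq u := forall e : R, 0 < e ->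
  exists N, forall i j, (N <= i)%N -> (N <= j)%N -> d (u i) (u j) < e.

Lemma cauchy_seq_cst (x : V) : cauchy_seq (fun=> x).
Proof. by move=> e e0; exists 0%N => i j _ _; rewrite ipm_distxx. Qed.

Lemma cauchy_seqN u : cauchy_seq u -> cauchy_seq (fun i => - u i).
Proof.
move=> cu e /cu[N uN]; exists N => i j Ni Nj.
by rewrite ipm_opp; exact: uN.
Qed.

Lemma cauchy_seqD u v :
  cauchy_seq u -> cauchy_seq v -> cauchy_seq (fun i => u i + v i).
Proof.
move=> cu cv e e0; have e20 : 0 < e / 2 by rewrite divr_gt0.
have [N uN] := cu _ e20; have [M vM] := cv _ e20.
exists (maxn N M) => i j; rewrite !geq_max => /andP[Ni Mi] /andP[Nj Mj].
apply: le_lt_trans (ipm_add _ _ _ _) _.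
by rewrite [ltRHS]splitr ltrD ?uN ?vM.
Qed.

Definition cauchy_type := {u : nat -> V | `[< cauchy_seq u >]}.
HB.instance Definition _ := Choice.on cauchy_type.

Definition mk_cauchy u (cu : cauchy_seq u) : cauchy_type := exist _ u (asboolT cu).

Lemma cauchy_typeP (u : cauchy_type) : cauchy_seq (val u).
Proof. exact/asboolP/(valP u). Qed.

Definition ceq (u v : cauchy_type) : bool :=
  `[< (fun i => d (val u i) (val v i)) @ \oo --> (0 : R) >].

Lemma cvg0_le (f g : nat -> R) : (forall i, 0 <= f i <= g i) ->
  g @ \oo --> (0 : R) -> f @ \oo --> (0 : R).
Proof.
move=> fg g0; apply: (@squeeze_cvgr _ _ _ _ (fun=> 0) g) => //.
- by near=> i; exact: fg.
- exact: cvg_cst.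
Unshelve. all: by end_near. Qed.

Lemma ceq_equiv : equiv_class_of ceq.
Proof.
split.
- move=> u; apply/asboolP.
  under eq_fun do rewrite ipm_distxx.
  exact: cvg_cst.
- move=> u v; apply/asboolP/asboolP => uv;
  by under eq_fun do rewrite ipm_sym.
- move=> v u w /asboolP uv /asboolP vw; apply/asboolP.
  apply: (cvg0_le _ (_ : (fun i => d (val u i) (val v i) + d (val v i) (val w i))
    @ \oo --> (0 : R))) => [i|]; first by rewrite ipm_ge0 ipm_triangle.
  by rewrite -[0 : R]addr0; exact: cvgD.
Qed.

Canonical ceq_rel := EquivRelPack ceq_equiv.

(* Cauchy sequences modulo d (u i) (v i) --> 0 *)
Definition completion := {eq_quot ceq_rel}.
HB.instance Definition _ := Choice.on completion.
HB.instance Definition _ := EqQuotient.on completion.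

(* a Cauchy sequence representing y *)
Definition rseq (y : completion) : nat -> V := val (repr y).

Lemma rseq_cauchy y : cauchy_seq (rseq y).
Proof. exact: cauchy_typeP. Qed.

Definition cpi u (cu : cauchy_seq u) : completion := \pi_completion (mk_cauchy cu).

Lemma cpi_eq u v (cu : cauchy_seq u) (cv : cauchy_seq v) :
  (fun i => d (u i) (v i)) @ \oo --> (0 : R) -> cpi cu = cpi cv.
Proof. by move=> uv; apply/eqmodP/asboolP. Qed.

Lemma rseq_cpi u (cu : cauchy_seq u) :
  (fun i => d (rseq (cpi cu) i) (u i)) @ \oo --> (0 : R).
Proof.
have : \pi_completion (repr (cpi cu)) = \pi_completion (mk_cauchy cu).
  by rewrite reprK.
by move/eqmodP/asboolP.
Qed.

Lemma cpi_rseq y : cpi (@rseq_cauchy y) = y.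
Proof.
rewrite -[RHS]reprK; apply/eqmodP/asboolP => /=.
under eq_fun do rewrite ipm_distxx.
exact: cvg_cst.
Qed.

Definition canonical_map (x : V) : completion := cpi (cauchy_seq_cst x).

Definition cadd (y z : completion) : completion :=
  cpi (cauchy_seqD (@rseq_cauchy y) (@rseq_cauchy z)).
Definition copp (y : completion) : completion := cpi (cauchy_seqN (@rseq_cauchy y)).

Lemma cadd_cpi u v (cu : cauchy_seq u) (cv : cauchy_seq v) :
  cadd (cpi cu) (cpi cv) = cpi (cauchy_seqD cu cv).
Proof.
apply: cpi_eq; apply: (cvg0_le _ (_ : (fun i => d (rseq (cpi cu) i) (u i)
  + d (rseq (cpi cv) i) (v i)) @ \oo --> (0 : R))) => [i|].
  by rewrite ipm_ge0 ipm_add.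
by rewrite -[0 : R]addr0; apply: cvgD; exact: rseq_cpi.
Qed.

Lemma copp_cpi u (cu : cauchy_seq u) : copp (cpi cu) = cpi (cauchy_seqN cu).
Proof. by apply: cpi_eq; under eq_fun do rewrite ipm_opp; exact: rseq_cpi. Qed.

Lemma cpi_ext u v (cu : cauchy_seq u) (cv : cauchy_seq v) :
  u =1 v -> cpi cu = cpi cv.
Proof.
move=> uv; apply: cpi_eq; under eq_fun do rewrite uv ipm_distxx.
exact: cvg_cst.
Qed.

Lemma caddA : associative cadd.
Proof.
move=> x y z; rewrite -(cpi_rseq x) -(cpi_rseq y) -(cpi_rseq z) !cadd_cpi.
by apply: cpi_ext => i; rewrite addrA.
Qed.

Lemma caddC : commutative cadd.
Proof.
move=> x y; rewrite -(cpi_rseq x) -(cpi_rseq y) !cadd_cpi.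
by apply: cpi_ext => i; rewrite addrC.
Qed.

Lemma cadd0 : left_id (canonical_map 0) cadd.
Proof.
move=> x; rewrite -(cpi_rseq x) cadd_cpi.
by apply: cpi_ext => i; rewrite add0r.
Qed.

Lemma caddN : left_inverse (canonical_map 0) copp cadd.
Proof.
move=> x; rewrite -(cpi_rseq x) copp_cpi cadd_cpi.
by apply: cpi_ext => i; rewrite addNr.
Qed.

HB.instance Definition _ := GRing.isZmodule.Build completion caddA caddC cadd0 caddN.

Lemma ipm_dist2 (x y x' y' : V) : `|d x y - d x' y'| <= d x x' + d y y'.
Proof.
have h (a b a' b' : V) : d a b <= d a a' + d b b' + d a' b'.
  apply: le_trans (ipm_triangle d a' _ _) _; rewrite -addrA lerD2l.
  by apply: le_trans (ipm_triangle d b' _ _) _; rewrite (ipm_sym _ b' b) addrC.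
rewrite ler_norml; apply/andP; split.
  rewrite lerBrDr addrC lerBlDr (ipm_sym _ x x') (ipm_sym _ y y') addrC.
  exact: h.
by rewrite lerBlDr; exact: h.
Qed.

Lemma cvg_dist u v : cauchy_seq u -> cauchy_seq v ->
  cvgn (fun i => d (u i) (v i)).
Proof.
move=> cu cv; apply/cauchy_cvgP/cauchy_exP => e e0.
have e20 : 0 < e / 2 by rewrite divr_gt0.
have [N uN] := cu _ e20; have [M vM] := cv _ e20.
exists (d (u (maxn N M)) (v (maxn N M))).
exists (maxn N M) => // i /= Ni; rewrite /ball/=.
apply: le_lt_trans (ipm_dist2 _ _ _ _) _; move: Ni; rewrite geq_max => /andP[Ni Mi].
by rewrite [ltRHS]splitr ltrD ?uN ?vM// ?leq_maxl ?leq_maxr.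
Qed.

Definition cdist (x y : completion) : R := limn (fun i => d (rseq x i) (rseq y i)).

Lemma cdistP (x y : completion) :
  (fun i => d (rseq x i) (rseq y i)) @ \oo --> cdist x y.
Proof. exact: (cvg_dist (@rseq_cauchy x) (@rseq_cauchy y)). Qed.

Lemma cdistxx (x : completion) : cdist x x = 0.
Proof.
rewrite /cdist; under eq_fun do rewrite ipm_distxx.
exact: (@lim_cst R^o).
Qed.

Lemma cdist_eq0 (x y : completion) : cdist x y = 0 -> x = y.
Proof.
by move=> xy; rewrite -(cpi_rseq x) -(cpi_rseq y); apply: cpi_eq; rewrite -xy; exact: cdistP.
Qed.

Lemma cdist_sym (x y : completion) : cdist x y = cdist y x.
Proof. by rewrite /cdist; under eq_fun do rewrite ipm_sym. Qed.

Lemma cdist_triangle (y x z : completion) : cdist x z <= cdist x y + cdist y z.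
Proof.
have xyz : (fun i => d (rseq x i) (rseq y i) + d (rseq y i) (rseq z i)) @ \oo
    --> cdist x y + cdist y z by apply: cvgD; exact: cdistP.
apply: (ler_cvg_to (@cdistP x z) xyz).
by near=> i; exact: ipm_triangle.
Unshelve. all: by end_near. Qed.

HB.instance Definition _ := isPointed.Build completion (canonical_map 0).
HB.instance Definition _ := @isMetric.Build R completion cdist
  cdistxx cdist_eq0 cdist_sym cdist_triangle.
HB.instance Definition _ := @isMeasurable.Build (sigma_display (@open completion))
  completion <<s @open completion >> (@sigma_algebra0 _ setT _)
  (@sigma_algebraC _ _) (@sigma_algebra_bigcup _ setT _).

End CauchySequences.

Section ColumnMeasurable.
Context {d} {T : measurableType d}.
Variable n : nat.

Let coord (i : 'I_n) (x : 'cV[T]_n) : T := x i ord0.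

(* the sigma-algebra generated by the coordinates; for T = R it is the Borel
   sigma-algebra of R^n *)
HB.instance Definition _ := @isMeasurable.Build (measure_tuple_display d)
  'cV[T]_n (g_sigma_preimage coord) (@sigma_algebra0 _ setT _)
  (@sigma_algebraC _ _) (@sigma_algebra_bigcup _ setT _).

Lemma measurable_col_coord (i : 'I_n) :
  measurable_fun [set: 'cV[T]_n] (fun x => x i ord0).
Proof.
move=> _ Y mY; rewrite setTI; apply: sub_sigma_algebra => /=.
rewrite -bigcup_seq/=; exists i => /=; first by rewrite mem_index_enum.
by exists Y => //; rewrite setTI.
Qed.

Lemma measurable_fun_colP d' (T' : measurableType d') (f : T' -> 'cV[T]_n) :
  (forall i, measurable_fun [set: T'] (fun t => f t i ord0)) ->
  measurable_fun [set: T'] f.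
Proof.
move=> mf; apply: (@measurability _ _ _ _ _ _
  (\big[setU/set0]_(i < n) preimage_set_system setT (coord i) measurable)) => //.
move=> _ [B + <-]; rewrite -bigcup_seq/= => -[i _ [C mC <-]].
by rewrite setTI; exact: mf.
Qed.

End ColumnMeasurable.

Section LebesgueN.
Variable R : realType.

Definition cons_col n (p : 'cV[R]_n * R) : 'cV[R]_n.+1 :=
  \col_i oapp (fun j => p.1 j ord0) p.2 (unlift ord0 i).

Lemma measurable_cons_col n : measurable_fun [set: 'cV[R]_n * R] (@cons_col n).
Proof.
apply: measurable_fun_colP => i.
under eq_fun do rewrite mxE.
case: (unlift ord0 i) => [j|] /=; last exact: measurable_snd.
apply: (@measurableT_comp _ _ _ _ _ _ (fun x : 'cV[R]_n => x j ord0)) => //.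
exact: measurable_col_coord.
Qed.

Section Step.
Variables (n : nat) (m : {measure set 'cV[R]_n -> \bar R}).

Definition lebesgue_step : set 'cV[R]_n.+1 -> \bar R :=
  pushforward (m \x (@lebesgue_measure R))%E (@cons_col n).

Let lebesgue_step_measure : {measure set 'cV[R]_n.+1 -> \bar R} :=
  measure_function_pushforward__canonical__measure_function_Measure
    [the {measure set _ -> \bar R} of (m \x (@lebesgue_measure R))%E]
    (@measurable_cons_col n).

HB.instance Definition _ := Measure.copy lebesgue_step lebesgue_step_measure.

End Step.

(* n-fold product of the one-dimensional Lebesgue measure, transported at each
   step along the bijection cons_col : R^n * R -> R^(n+1) *)
Fixpoint lebesgueN n : {measure set 'cV[R]_n -> \bar R} :=
  match n with
  | 0 => [the {measure set 'cV[R]_0 -> \bar R} of dirac (0 : 'cV[R]_0)]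
  | m.+1 => [the {measure set 'cV[R]_m.+1 -> \bar R} of lebesgue_step (lebesgueN m)]
  end.

End LebesgueN.

Definition expanding n (A : 'M[rat]_n) : Prop :=
  forall z : algC, eigenvalue (map_mx ratr A) z -> 1 < `|z|.

Definition int_col n (z : 'cV[int]_n) : 'cV[rat]_n := map_mx intr z.

Section Lattices.
Variable n : nat.
Implicit Types (M B : 'M[rat]_n.+1) (z : nat -> 'cV[int]_n.+1).

(* Z^n[M]; the values of z beyond k are irrelevant *)
Definition Zspan M : set 'cV[rat]_n.+1 :=
  [set x | exists k z, (0 < k)%N /\ x = \sum_(i < k) M ^+ i *m int_col (z i)].

(* Z^n(B); the index i stands for the exponent i - k in -k .. k *)
Definition Zlaurent B : set 'cV[rat]_n.+1 :=
  [set x | exists k z, (0 < k)%N /\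
    x = \sum_(i < k.*2.+1) B ^ (i%:Z - k%:Z) *m int_col (z i)].

(* |Z^n[M] / M Z^n[M]|, counted as a set of cosets; the value would be 0 if the
   quotient were infinite *)
Definition Zindex M : nat :=
  #|` fset_set [set [set x + M *m y | y in Zspan M] | x in Zspan M]|.

Lemma int_col0 : int_col (0 : 'cV[int]_n.+1) = 0.
Proof. by apply/matrixP => i j; rewrite !mxE. Qed.

Lemma int_colD (z w : 'cV[int]_n.+1) : int_col (z + w) = int_col z + int_col w.
Proof. by apply/matrixP => i j; rewrite !mxE intrD. Qed.

Lemma int_colN (z : 'cV[int]_n.+1) : int_col (- z) = - int_col z.
Proof. by apply/matrixP => i j; rewrite !mxE intrN. Qed.

Lemma Zspan_pad M k m z : (k <= m)%N ->
  \sum_(i < k) M ^+ i *m int_col (z i) =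
  \sum_(i < m) M ^+ i *m int_col (if (i < k)%N then z i else 0).
Proof.
move=> km; rewrite (big_ord_widen m (fun i => M ^+ i *m int_col (z i)))//.
rewrite big_mkcond; apply: eq_bigr => i _.
by case: ifP => // _; rewrite int_col0 mulmx0.
Qed.

Lemma Zspan0 M : Zspan M 0.
Proof.
exists 1%N, (fun=> 0); split=> //.
by rewrite big1// => i _; rewrite int_col0 mulmx0.
Qed.

Lemma ZspanN M x : Zspan M x -> Zspan M (- x).
Proof.
move=> [k [z [k0 ->]]]; exists k, (fun i => - z i); split=> //.
by rewrite -sumrN; apply: eq_bigr => i _; rewrite int_colN mulmxN.
Qed.

Lemma ZspanD M x y : Zspan M x -> Zspan M y -> Zspan M (x + y).
Proof.
move=> [k [z [k0 ->]]] [m [w [m0 ->]]].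
exists (maxn k m), (fun i => (if (i < k)%N then z i else 0) +
  (if (i < m)%N then w i else 0)); split; first by rewrite leq_max k0.
rewrite (Zspan_pad _ _ (leq_maxl k m)) (Zspan_pad _ _ (leq_maxr k m)).
by rewrite -big_split; apply: eq_bigr => i _; rewrite int_colD mulmxDr.
Qed.

Lemma Zspan_mul M x : Zspan M x -> Zspan M (M *m x).
Proof.
move=> [k [z [k0 ->]]]; exists k.+1, (fun i => if i is j.+1 then z j else 0).
split=> //; rewrite big_ord_recl int_col0 mulmx0 add0r mulmx_sumr.
by apply: eq_bigr => i _; rewrite /= /bump/= add1n mulmxA exprS.
Qed.

Lemma Zlaurent_pad B k m z : (k <= m)%N -> exists w : nat -> 'cV[int]_n.+1,
  \sum_(i < k.*2.+1) B ^ (i%:Z - k%:Z) *m int_col (z i) =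
  \sum_(i < m.*2.+1) B ^ (i%:Z - m%:Z) *m int_col (w i).
Proof.
elim: m => [|m IH]; first by rewrite leqn0 => /eqP ->; exists z.
rewrite leq_eqVlt => /orP[/eqP ->|/IH[w ->]]; first by exists z.
exists (fun i => if i is j.+1 then if (j < m.*2.+1)%N then w j else 0 else 0).
rewrite doubleS [RHS]big_ord_recl int_col0 mulmx0 add0r [RHS]big_ord_recr/=.
rewrite /bump/= add1n ltnn int_col0 mulmx0 addr0; apply: eq_bigr => i _.
rewrite /= /bump/= add1n ltn_ord; congr (B ^ _ *m _).
by lia.
Qed.

Lemma Zlaurent0 B : Zlaurent B 0.
Proof.
exists 1%N, (fun=> 0); split=> //.
by rewrite big1// => i _; rewrite int_col0 mulmx0.
Qed.

Lemma ZlaurentN B x : Zlaurent B x -> Zlaurent B (- x).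
Proof.
move=> [k [z [k0 ->]]]; exists k, (fun i => - z i); split=> //.
by rewrite -sumrN; apply: eq_bigr => i _; rewrite int_colN mulmxN.
Qed.

Lemma ZlaurentD B x y : Zlaurent B x -> Zlaurent B y -> Zlaurent B (x + y).
Proof.
move=> [k [z [k0 ->]]] [m [w [m0 ->]]].
have [z' ->] := Zlaurent_pad B z (leq_maxl k m).
have [w' ->] := Zlaurent_pad B w (leq_maxr k m).
exists (maxn k m), (fun i => z' i + w' i); split; first by rewrite leq_max k0.
by rewrite -big_split; apply: eq_bigr => i _; rewrite int_colD mulmxDr.
Qed.

Lemma Zlaurent_sum B (I : Type) (r : seq I) (P : pred I) F :
  (forall i, P i -> Zlaurent B (F i)) -> Zlaurent B (\sum_(i <- r | P i) F i).
Proof. by move=> PF; apply: big_ind => //; [exact: Zlaurent0|exact: ZlaurentD]. Qed.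

Lemma Zlaurent_term B (j : int) (z : 'cV[int]_n.+1) :
  Zlaurent B (B ^ j *m int_col z).
Proof.
pose k := `|j|%N.+1; have jk0 : 0 <= j + k%:Z by rewrite /k; lia.
have jk : (absz (j + k%:Z)%R < k.*2.+1)%N by rewrite /k; lia.
exists k, (fun i => if i == absz (j + k%:Z) then z else 0); split=> //.
rewrite (bigD1 (Ordinal jk))//= eqxx gez0_abs// addrK.
rewrite big1 ?addr0// => i /negPf ij.
by rewrite ifF ?int_col0 ?mulmx0// -ij -val_eqE.
Qed.

Lemma Zspan_Zlaurent A x : A \is a GRing.unit -> Zspan A x -> Zlaurent A^-1 x.
Proof.
move=> uA [k [z [k0 ->]]]; apply: Zlaurent_sum => i _.
have -> : A ^+ i = A^-1 ^ (- i%:Z) by rewrite exprz_inv opprK.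
exact: Zlaurent_term.
Qed.

Lemma Zlaurent_mul A x : A \is a GRing.unit ->
  Zlaurent A^-1 x -> Zlaurent A^-1 (A *m x).
Proof.
move=> uA [k [z [k0 ->]]]; rewrite mulmx_sumr; apply: Zlaurent_sum => i _.
rewrite mulmxA; have -> : A *m A^-1 ^ (i%:Z - k%:Z) = A^-1 ^ (-1 + (i%:Z - k%:Z)).
  by rewrite [RHS]exprzDr ?unitrV// [A^-1 ^ (-1)]exprz_inv opprK expr1z.
exact: Zlaurent_term.
Qed.

End Lattices.

Section LaurentType.
Variables (n : nat) (B : 'M[rat]_n.+1).

Definition laurent_pred : {pred 'cV[rat]_n.+1} := fun x => `[< Zlaurent B x >].

Lemma laurent_zmod_closed : zmod_closed laurent_pred.
Proof.
split=> [|x y /asboolP Bx /asboolP By]; apply/asboolP; first exact: Zlaurent0.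
by apply: ZlaurentD => //; exact: ZlaurentN.
Qed.

HB.instance Definition _ :=
  GRing.isZmodClosed.Build 'cV[rat]_n.+1 laurent_pred laurent_zmod_closed.

Record laurent := Laurent {
  laurent_val : 'cV[rat]_n.+1 ;
  laurentP : laurent_val \in laurent_pred }.

HB.instance Definition _ := [isSub for laurent_val].
HB.instance Definition _ := [Choice of laurent by <:].
HB.instance Definition _ := [SubChoice_isSubZmodule of laurent by <:].

End LaurentType.

Section Metric.
Variables (R : realType) (n : nat) (B : 'M[rat]_n.+1).
Hypotheses (uB : B \is a GRing.unit) (b_gt1 : (1 < Zindex B)%N).

(* inf{k : y \notin B^(k+1) Z^n[B]}: the infimum in \bar R gives
   inf set0 = +oo; it is never -oo on Z^n(B) *)
Definition nu (y : 'cV[rat]_n.+1) : \bar R :=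
  ereal_inf [set (k%:~R)%:E | k in
    [set k : int | ~ [set B ^ (k + 1) *m x | x in Zspan B] y]].

(* e |-> b^(-e), with b^(-oo) = 0 *)
Definition powb (e : \bar R) : R :=
  if e is r%:E then ((Zindex B)%:R : R) `^ (- r) else 0.

Definition dB (x y : laurent B) : R := powb (nu (val x - val y)).

Lemma nu_ninfty (y : laurent B) : nu (val y) != -oo%E.
Proof.
case: y => y /= /asboolP[k [z [k0 ->]]].
set x := \sum_(i < _) _.
suff : ((- k%:Z)%:~R%:E <= nu x)%E by case: (nu x).
apply: le_ereal_inf_tmp => _ [j nj <-]; rewrite lee_fin ler_int leNgt.
apply/negP => jk; apply: nj => /=.
pose m := absz (- k%:Z - (j + 1))%R.
have mE : m%:Z = - k%:Z - (j + 1) by rewrite /m; lia.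
exists (B ^+ m *m \sum_(i < k.*2.+1) B ^+ i *m int_col (z i)).
  elim: m {mE} => [|m IH]; last by rewrite exprS -mulmxA; exact: Zspan_mul.
  by rewrite expr0 mul1mx; exists k.*2.+1, z.
rewrite mulmxA; have -> : B ^ (j + 1) *m B ^+ m = B ^ (- k%:Z).
  have -> : - k%:Z = j + 1 + m%:Z by rewrite mE addrC subrK.
  by rewrite [RHS]exprzDr.
rewrite mulmx_sumr; apply: eq_bigr => i _.
by rewrite mulmxA addrC [in RHS]exprzDr.
Qed.

Lemma nu0 : nu 0 = +oo%E.
Proof.
rewrite /nu (_ : [set k : int | _] = set0) ?image_set0 ?ereal_inf0//.
apply/seteqP; split=> // k /=; apply.
by exists 0; [exact: Zspan0|rewrite mulmx0].
Qed.

Lemma nuN y : nu (- y) = nu y.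
Proof.
suff h x : (nu x <= nu (- x))%E by apply/eqP; rewrite eq_le h -{2}(opprK y) h.
apply: le_ereal_inf_tmp => _ [k nk <-]; apply: ereal_inf_lbound; exists k => //= -[w Bw xE].
by apply: nk; exists (- w); [exact: ZspanN|rewrite mulmxN xE].
Qed.

Lemma nuD x y : (Order.min (nu x) (nu y) <= nu (x + y))%E.
Proof.
apply: le_ereal_inf_tmp => _ [k nk <-]; rewrite ge_min.
have [Bx|nBx] := pselect ([set B ^ (k + 1) *m x | x in Zspan B] x); last first.
  by apply/orP; left; apply: ereal_inf_lbound; exists k.
apply/orP; right; apply: ereal_inf_lbound; exists k => //= By; apply: nk.
move: Bx By => [v Bv <-] [w Bw <-]; exists (v + w); first exact: ZspanD.
by rewrite mulmxDr.
Qed.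

Lemma powb_ge0 e : 0 <= powb e.
Proof. by case: e => [r| |]//=; exact: powR_ge0. Qed.

Lemma powb_anti e f : e != -oo%E -> (e <= f)%E -> powb f <= powb e.
Proof.
case: e f => [r| |] [s| |] //= _; rewrite ?lee_fin ?leye_eq//.
by move=> rs; rewrite ler_powR ?lerN2// ler1n ltnW.
Qed.

Lemma dBxx x : dB x x = 0.
Proof. by rewrite /dB subrr nu0. Qed.

Lemma dB_sym x y : dB x y = dB y x.
Proof. by rewrite /dB -nuN opprB. Qed.

Lemma dB_triangle y x z : dB x z <= dB x y + dB y z.
Proof.
have := nuD (val x - val y) (val y - val z).
rewrite addrA subrK ge_min => /orP[] h.
  rewrite -[leLHS]addr0 lerD ?powb_ge0// powb_anti//.
  by rewrite -raddfB; exact: nu_ninfty.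
rewrite -[leLHS]add0r lerD ?powb_ge0// powb_anti//.
by rewrite -raddfB; exact: nu_ninfty.
Qed.

Lemma dB_invariant x y z : dB (x + z) (y + z) = dB x y.
Proof. by rewrite /dB -!raddfB opprD addrACA subrr addr0. Qed.

Definition dB_pseudometric : inv_pseudometric R (laurent B) :=
  InvPseudometric dBxx dB_sym dB_triangle dB_invariant.

End Metric.

Lemma expanding_unit n (A : 'M[rat]_n.+1) : expanding A -> A \is a GRing.unit.
Proof.
move=> eA; apply: contraT => uA; have : eigenvalue (map_mx ratr A : 'M[algC]_n.+1) 0.
  rewrite -(rmorph0 (@ratr algC)) eigenvalue_map; apply/eigenvalueP.
  move: uA; rewrite -[_ \is a _]/(A \in unitmx) unitmxE unitfE negbK => /det0P[v v0 vA].
  by exists v => //; rewrite vA scale0r.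
by move/eA; rewrite normr0 ltr10.
Qed.

Section RepresentationSpace.
Variables (R : realType) (n : nat) (A : 'M[rat]_n.+1).
Hypotheses (eA : expanding A) (b_ge2 : (2 <= Zindex A^-1)%N).

Let uA : A \is a GRing.unit := expanding_unit eA.
Let uB : A^-1 \is a GRing.unit. Proof. by rewrite unitrV. Qed.

(* Z^n((B)), with its Borel sigma-algebra *)
Definition ZB_completion := completion (dB_pseudometric R uB b_ge2).

(* the extensions by continuity of nu and of the multiplication by A *)
Definition nu_completion (y : ZB_completion) : \bar R :=
  limn (fun i => nu R A^-1 (val (rseq y i))).

Lemma laurent_mul_subproof (x : laurent A^-1) :
  A *m val x \in laurent_pred A^-1.
Proof. by apply/asboolP; apply: Zlaurent_mul => //; exact/asboolP/(valP x). Qed.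

Definition laurent_mul (x : laurent A^-1) : laurent A^-1 :=
  Laurent (laurent_mul_subproof x).

Definition mul_completion (y : ZB_completion) : ZB_completion :=
  limn (fun i => canonical_map _ (laurent_mul (rseq y i)) : ZB_completion).

(* Z^n[[B]] *)
Definition ZB_integers : set ZB_completion := [set y | (0 <= nu_completion y)%E].

(* Any Borel measure with these properties is a Haar measure: it is finite on
   compact sets, and regular since the space is second countable *)
Definition normalized_haar (mu : set ZB_completion -> \bar R) : Prop :=
  (forall (y : ZB_completion) (E : set ZB_completion),
    measurable E -> mu [set y + x | x in E] = mu E) /\
  mu ZB_integers = 1%E.

(* Only the topology of K_A matters below; the library's sup norm on column
   vectors induces the same one as the Euclidean norm *)
Definition KA : Type := ('cV[R]_n.+1 * ZB_completion)%type.

Definition mul_KA (p : KA) : KA := (map_mx ratr A *m p.1, mul_completion p.2).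

Definition phi (x : laurent A^-1) : KA :=
  (map_mx ratr (val x), canonical_map _ x).

Definition translate (F : set KA) (s : KA) : set KA := [set p + s | p in F].

Definition is_tile (D : {fset 'cV[rat]_n.+1}) (F : set KA) : Prop :=
  [/\ F !=set0, compact F &
   mul_KA @` F = \bigcup_(d in [set d | val d \in D]) translate F (phi d)].

(* the sets containing p are counted, not the translations s *)
Definition multiple_tiling (mu : set KA -> \bar R) (F S : set KA) : Prop :=
  exists2 k : nat, (1 <= k)%N &
    {ae mu, forall p : KA,
      ([set X | X p /\ exists2 s, S s & X = translate F s] #= `I_k)%card}.

End RepresentationSpace.

Definition digit_system n (A : 'M[rat]_n.+1) (D : {fset 'cV[rat]_n.+1}) : Prop :=
  [/\ expanding A, [set` D] `<=` Zspan A & #|` D| = Zindex A].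

(* Main.v *)
(* Let Gam = phi(Z^n[A]), and let C(p) be the number of g in Gam with
   p - g in F.  Since F is compact and Gam is discrete, the translates of F by
   Gam are locally finite, so that U = {C = min C} is open and nonempty.  If
   r_1, ..., r_a represent Gam / A Gam, then A F = \bigcup_d (F + phi d) and
   #|D| = a give, at every point q,
     C(A^-1 (q - r_1)) + ... + C(A^-1 (q - r_a)) <= a C(q),
   hence U is stable under A^-1 and under Gam.  So U contains the sets
   A^-k (c + Gam), k >= 0, for some small open c; at every scale k they occupy a
   fixed proportion of the space, which forces the complement of U to be null.

   Gam is discrete because the elements of Z^n[A] and Z^n[A^-1] in common have
   bounded denominators. *)
Require Import Defs.
From HB Require Import structures.
From mathcomp Require Import all_boot all_order all_algebra all_field.
From mathcomp Require Import finmap.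
From mathcomp Require Import all_classical all_reals all_analysis.
From mathcomp Require Import measurable_realfun zify.
Set Implicit Arguments.
Unset Strict Implicit.
Unset Printing Implicit Defensive.
Import Order.TTheory GRing.Theory Num.Theory.
Import numFieldNormedType.Exports.
Local Open Scope classical_set_scope.
Local Open Scope ring_scope.

(** * Common elements of Z^n[A] and Z^n[A^-1] *)

(** Taking the least value m of C takes the place of an ergodicity argument: summands that are all
    at least m and add up to at most a m must all equal m, so minimality passes from q to every A^-1
    (q - g) with g in Gam. What remains is to show that the minimal set is large, and since C is
    upper semicontinuous this becomes a statement about invariant open sets.

    Besides being discrete, Gam must be cocompact. This comes from Z^n(B) = Z^n[A] + Z^n[B]:
    translation by Gam removes the first summand, and the second lies in the unit ball.

    The effect of A on the measure is never computed. Only translates of one cell at a fixed scale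
    are compared, so translation invariance and finiteness on bounded boxes suffice.

    Positivity of mu(F) excludes m = 0. Counting distinct sets instead of translations requires that
    F have no nonzero period in Gam; a period would put infinitely many points of Gam in one
    incidence set. *)

Notation pZtoQ := (map_poly (intr : int -> rat)).

(** Gauss's lemma: if [s = t / a] then [f t = a g], and multiplicativity of contents lets
    [zcontents f] absorb [a]. The factor depends on [f] alone, so one bound serves every [g]. *)
Lemma gauss_content (f g : {poly int}) (s : {poly rat}) :
  pZtoQ f * s = pZtoQ g -> exists t : {poly int},
    (zcontents f)%:~R *: s = pZtoQ t.
Proof.
have [t [a a0 ->]] := rat_poly_scale s.
have a0' : a%:~R != 0 :> rat by rewrite intr_eq0.
rewrite -scalerAr => /(congr1 (fun p => a%:~R *: p)).
rewrite scalerA divff// scale1r -rmorphM -map_polyZ => /= /map_inj_poly ftg.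
have {}ftg : f * t = a *: g by apply: ftg => //; exact: intr_inj.
have := congr1 zcontents ftg; rewrite zcontentsM zcontentsZ => fE.
exists (zcontents g *: zprimitive t).
rewrite {1}(zpolyEprim t) !map_polyZ /= !scalerA; congr (_ *: _).
by rewrite mulrAC -intrM fE intrM mulrAC divff ?mul1r.
Qed.

Lemma common_denominator_poly m n (M : 'M[{poly rat}]_(m, n)) :
  exists d, exists2 Z : 'M[{poly int}]_(m, n),
    d != 0 :> int & d%:~R%:P *: M = map_mx pZtoQ Z.
Proof.
have h (p : 'I_m * 'I_n) : exists d : int * {poly int}, d.1 != 0 /\
    d.1%:~R *: M p.1 p.2 = pZtoQ d.2.
  have [t [a a0 ->]] := rat_poly_scale (M p.1 p.2).
  by exists (a, t); split; rewrite //= scalerA divff ?intr_eq0// scale1r.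
have [d dP] := boolp.choice h.
pose D (P : pred ('I_m * 'I_n)) := \prod_(p | P p) (d p).1.
exists (D xpredT), (\matrix_(i, j) (D (predC1 (i, j)) *: (d (i, j)).2)).
  by apply/prodf_neq0 => p _; case: (dP p).
apply/matrixP => i j; rewrite !mxE map_polyZ -[RHS]/((D _)%:~R *: pZtoQ (d (i, j)).2).
rewrite -(dP (i, j)).2 scalerA mul_polyC; congr (_ *: _).
by rewrite -intrM {1}/D (bigD1 (i, j))//= mulrC.
Qed.

Section IntegralIntersection.
Variables (n : nat) (A : 'M[rat]_n.+1).
Notation B := A^-1.

(* the quotient of X^i z - A^i z by X - A *)
Fixpoint geom_quo (i : nat) (z : 'cV[rat]_n.+1) : 'cV[{poly rat}]_n.+1 :=
  if i is j.+1 then 'X^j *: map_mx polyC z + geom_quo j (A *m z) else 0.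

Lemma geom_quoP i z : char_poly_mx A *m geom_quo i z =
  'X^i *: map_mx polyC z - map_mx polyC (A ^+ i *m z).
Proof.
elim: i z => [|i IH] z /=.
  by rewrite mulmx0 expr0 !scale1r mul1mx subrr.
rewrite mulmxDr IH -scalemxAr mulmxBl mul_scalar_mx scalerBr scalerA -exprSr.
by rewrite -map_mxM /= addrA subrK mulmxA mulmxE -exprSr.
Qed.

Lemma coef_geom_quo i z l r :
  (geom_quo i z r 0)`_l = if (l < i)%N then (A ^+ (i - l.+1) *m z) r 0 else 0.
Proof.
elim: i z => [|i IH] z /=; first by rewrite mxE coef0.
rewrite 3!mxE coefD coefMC coefXn IH ltnS subSS.
rewrite mulmxA mulmxE -exprSr; have [li|il|->] := ltngtP l i.
- by rewrite mul0r add0r subnSK.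
- by rewrite mul0r add0r.
- by rewrite subnn expr0 mul1mx mul1r addr0.
Qed.

(* Write x as a polynomial with integral coefficients both in A and in A^-1,
   and subtract: this gives an integral polynomial vector V with V(A) = 0, so
   V = (X - A) S.  Since char_poly A * S = adj (X - A) * V, Gauss's lemma bounds
   the denominators of S, and one coefficient y of S satisfies x = z_0 + A y. *)
Lemma bounded_denominators : A \is a GRing.unit ->
  exists2 N : nat, (0 < N)%N & forall x, Zspan A x -> Zspan B x ->
    exists w : 'cV[int]_n.+1, N%:R *: x = int_col w.
Proof.
move=> uA.
have [d1 [Z1 d10 Z1E]] := common_denominator_poly (\matrix_(i < 1, j < 1) char_poly A).
have [d2 [Z2 d20 Z2E]] := common_denominator_poly (\adj (char_poly_mx A)).
have [d3 [Z3 d30 Z3E]] := common_denominator_poly (map_mx polyC A).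
have {}Z1E : d1%:~R *: char_poly A = pZtoQ (Z1 0 0).
  by have /matrixP/(_ 0 0) := Z1E; rewrite !mxE mul_polyC.
have {}Z3E : d3%:~R *: A = map_mx intr (\matrix_(i, j) (Z3 i j)`_0).
  apply/matrixP => i j; have /matrixP/(_ i j)/(congr1 (fun p : {poly rat} => p`_0)) := Z3E.
  by rewrite !mxE coef_map coefMC coefC.
(* [f] is d1 d2 [char_poly A], integral and independent of x. Since d1 [Z2 *m V] is [f] times [S]
   entrywise, its content clears the denominators of every [S]. *)
pose f := d2 *: Z1 0 0.
have f0 : zcontents f != 0.
  rewrite zcontents_eq0 /f -mul_polyC mulf_eq0 polyC_eq0 negb_or d20 /=; apply/eqP => Z0.
  move: Z1E; rewrite Z0 rmorph0 => /eqP.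
  by rewrite scaler_eq0 intr_eq0 (negPf d10) /= (negPf (monic_neq0 (char_poly_monic _))).
(* [zcontents f] clears the denominators of y, and d3 those of A, in x = z_0 + A y. *)
exists (absz (d3 * zcontents f)%R); first by rewrite absz_gt0 mulf_neq0.
move=> x [k [z [k0 xE]]] [l [w [l0 xE']]].
case: k z k0 xE => // k z _ xE; case: l w l0 xE' => // l w _ xE'.
(* Multiplying by X^l turns the exponents -j of A into l - j. At A both sums in [V] evaluate to A^l
   x, so [V] vanishes there and [S] is its quotient by X - A. *)
pose S := \sum_(i < k.+1) geom_quo (l + i) (int_col (z i)) -
          \sum_(j < l.+1) geom_quo (l - j) (int_col (w j)).
pose V : 'cV[{poly int}]_n.+1 := \sum_(i < k.+1) 'X^(l + i) *: map_mx polyC (z i) -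
         \sum_(j < l.+1) 'X^(l - j) *: map_mx polyC (w j).
have SV : char_poly_mx A *m S = map_mx pZtoQ V.
  have hS m (e : nat -> nat) (y : nat -> 'cV[int]_n.+1) :
      char_poly_mx A *m (\sum_(i < m) geom_quo (e i) (int_col (y i))) =
      map_mx pZtoQ (\sum_(i < m) 'X^(e i) *: map_mx polyC (y i)) -
      map_mx polyC (\sum_(i < m) A ^+ (e i) *m int_col (y i)).
    rewrite mulmx_sumr 2!raddf_sum /= -sumrB; apply: eq_bigr => i _.
    rewrite geom_quoP; congr (_ - _); apply/matrixP => r j.
    by rewrite !mxE rmorphM /= map_polyXn map_polyC.
  have hw : \sum_(j < l.+1) A ^+ (l - j) *m int_col (w j) = A ^+ l *m x.
    rewrite xE' mulmx_sumr; apply: eq_bigr => j _; rewrite mulmxA; congr (_ *m _).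
    have jl : (j <= l)%N by rewrite -ltnS.
    have -> : A ^+ l = A ^+ (l - j) *m A ^+ j by rewrite mulmxE -exprD subnK.
    by rewrite mulmxE -mulrA exprVn mulrV ?mulr1// unitrX.
  have hz : \sum_(j < k.+1) A ^+ (l + j) *m int_col (z j) = A ^+ l *m x.
    by rewrite xE mulmx_sumr; apply: eq_bigr => j _; rewrite mulmxA exprD mulmxE.
  rewrite mulmxBr (hS _ (addn l)) (hS _ (subn l)) hw hz /V map_mxB.
  by rewrite opprB addrA subrK.
have fS r : exists t : {poly int}, (zcontents f)%:~R *: S r 0 = pZtoQ t.
  apply: (@gauss_content _ (d1%:P * (Z2 *m V) r 0)).
  clearbody S V; have Z2V : map_mx pZtoQ (Z2 *m V) = d2%:~R%:P *: (char_poly A *: S).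
    by rewrite map_mxM -Z2E -scalemxAl -SV mulmxA mul_adj_mx mul_scalar_mx.
  move/matrixP/(_ r 0): Z2V; rewrite [in LHS]mxE => Z2Vr.
  rewrite rmorphM /= map_polyC /=.
  apply: (etrans _ (congr1 (fun p => d1%:~R%:P * p) (esym Z2Vr))) => /=.
  rewrite [in RHS]mxE [in RHS]mxE /f map_polyZ /= -Z1E -!mul_polyC !mulrA; congr (_ * _ * _); exact: mulrC.
have {}fS r : exists t : int, (zcontents f)%:~R *
    (\sum_(i < k) A ^+ i *m int_col (z i.+1)) r 0 = t%:~R.
  have [t tE] := fS r; exists t`_l; move/(congr1 (fun p : {poly rat} => p`_l)): tE.
  rewrite coefZ coef_map => <-; congr (_ * _).
  (* In degree l the second sum contributes nothing, its terms having degree below l - j, and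
     neither does the term i = 0 of the first. The others leave A^(i-1) z_i, whose sum is y. *)
  rewrite /S mxE coefD mxE coefN !summxE !coef_sum.
  rewrite [X in _ = _ - X]big1 ?subr0; last first.
    by move=> i _; rewrite coef_geom_quo ltnNge leq_subr.
  rewrite big_ord_recl /= coef_geom_quo addn0 ltnn add0r.
  apply: eq_bigr => i _; rewrite coef_geom_quo /= /bump /= addnS ltnS leq_addr.
  by rewrite add1n subSS addnC addnK.
have [t tE] := boolp.choice fS.
pose t' : 'cV[int]_n.+1 := \col_r t r.
suff [w' w'E] : exists w' : 'cV[int]_n.+1,
    (d3 * zcontents f)%:~R *: x = int_col w'.
  have [c0|c0] := leP 0 (d3 * zcontents f)%R.
    by exists w'; rewrite -w'E -[in RHS](gez0_abs c0) //.
  exists (- w'); rewrite int_colN -w'E -scaleNr -intrN; congr (_ *: _).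
  by rewrite -(ltz0_abs c0).
exists ((d3 * zcontents f)%R *: z 0%N + (\matrix_(i, j) (Z3 i j)`_0) *m t').
rewrite int_colD /int_col map_mxZ map_mxM /= -Z3E.
have -> : map_mx intr t' = (zcontents f)%:~R *: \sum_(i < k) A ^+ i *m int_col (z i.+1).
  by apply/matrixP => i j; rewrite ord1 [RHS]mxE tE !mxE.
rewrite xE big_ord_recl expr0 mul1mx scalerDr; congr (_ + _).
rewrite -scalemxAl -scalemxAr scalerA intrM; congr (_ *: _).
rewrite mulmx_sumr; apply: eq_bigr => i _.
by rewrite /= /bump /= add1n exprS -mulmxE mulmxA.
Qed.

End IntegralIntersection.

(** * Powers of the inverse of an expanding matrix *)

(** For u_k = B^k P the difference is B^k (B - lam) P, so one application strips one factor from a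
    product. Repeated eigenvalues need no separate treatment: each factor only costs a larger
    ratio. *)
Lemma geometric_bound_step (m : nat) (u : nat -> 'M[algC]_m) (lam : algC) :
  `|lam| < 1 ->
  (exists C r : algC, [/\ 0 <= C, 0 <= r, r < 1 &
    forall k i j, `|u k.+1 i j - lam * u k i j| <= C * r ^+ k]) ->
  exists C r : algC, [/\ 0 <= C, 0 <= r, r < 1 &
    forall k i j, `|u k i j| <= C * r ^+ k].
Proof.
set s := `|lam| => s1 [C [r [C0 r0 r1 uC]]].
have s0 : 0 <= s by rewrite normr_ge0.
have s1' : 0 < 1 - s by rewrite subr_gt0.
have r1' : 0 < 1 - r by rewrite subr_gt0.
(* The ratio [q = 1 - e] must exceed [s] and [r] and stay below 1. This [e] lies below both 1 - s
   and 1 - r without comparing the two, the order of [algC] being partial. *)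
pose e := (1 - s) * (1 - r) / 2.
have e0 : 0 < e by rewrite divr_gt0 ?mulr_gt0// ltr0n.
have es : e < 1 - s.
  rewrite /e -mulrA gtr_pMr// ltr_pdivrMr ?ltr0n// mul1r.
  by apply: le_lt_trans (_ : 1 < 2); [rewrite gerBl|rewrite ltr1n].
have er : e < 1 - r.
  rewrite /e mulrAC gtr_pMl// ltr_pdivrMr ?ltr0n// mul1r.
  by apply: le_lt_trans (_ : 1 < 2); [rewrite gerBl|rewrite ltr1n].
pose q := 1 - e.
have qs : 0 < q - s by rewrite /q addrAC subr_gt0.
have rq : r <= q by rewrite /q lerBrDl -lerBrDr ltW.
have q0 : 0 <= q by apply: le_trans rq.
pose U := \sum_i \sum_j `|u 0%N i j|.
have U0 : 0 <= U by do 2 (apply: sumr_ge0 => ? _); rewrite normr_ge0.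
(* [U] bounds the entries at k = 0, and C' = C / (q - s) solves C + s C' = q C', which closes the
   induction. *)
exists (U + C / (q - s)), q; split=> //.
- by rewrite addr_ge0// divr_ge0// ltW.
- by rewrite /q ltrBlDr ltrDl.
elim=> [|k IH] i j.
  rewrite expr0 mulr1; apply: (@le_trans _ _ U).
    rewrite /U (bigD1 i)//= (bigD1 j)//= -addrA lerDl addr_ge0//.
      by apply: sumr_ge0 => ? _; rewrite normr_ge0.
    by do 2 (apply: sumr_ge0 => ? _); rewrite normr_ge0.
  by rewrite lerDl divr_ge0// ltW.
rewrite -(subrK (lam * u k i j) (u k.+1 i j)).
apply: le_trans (ler_normD _ _) _; rewrite normrM -/s.
apply: (@le_trans _ _ (C * q ^+ k + s * ((U + C / (q - s)) * q ^+ k))).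
  apply: lerD; last by rewrite ler_wpM2l.
  by apply: le_trans (uC _ _ _) _; rewrite ler_wpM2l// lerXn2r// nnegrE.
rewrite mulrA -mulrDl exprS mulrA ler_wpM2r ?exprn_ge0//.
rewrite [leRHS]mulrC -lerBrDr -mulrBl mulrDr.
by rewrite [X in _ + X]mulrCA divff ?mulr1 ?gt_eqF// lerDr mulr_ge0// ltW.
Qed.

(* By Cayley-Hamilton, A^-k (A^-1 - z_1) ... (A^-1 - z_m) = 0; the factors are
   removed one by one. *)
Lemma expanding_inv_bound n (A : 'M[rat]_n.+1) : expanding A ->
  exists C t : rat, [/\ 0 <= C, 0 <= t, t < 1 &
    forall k i j, `|(A^-1 ^+ k) i j| <= C * t ^+ k].
Proof.
move=> eA; have uA := expanding_unit eA.
pose B : 'M[algC]_n.+1 := map_mx ratr A^-1.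
have [s sE] := closed_field_poly_normal (char_poly B).
have {}sE : char_poly B = \prod_(z <- s) ('X - z%:P).
  by move: sE; rewrite (monicP (char_poly_monic B)) scale1r.
have s1 z : z \in s -> `|z| < 1.
  rewrite -root_prod_XsubC -sE -eigenvalue_root_char => /eigenvalueP[v vB v0].
  have BA : B *m map_mx ratr A = 1%:M.
    by rewrite -map_mxM mulmxE mulVr//= map_mx1.
  have z0 : z != 0.
    apply: contraNneq v0 => z0; have := congr1 (mulmx^~ (map_mx ratr A)) vB.
    by rewrite -mulmxA BA mulmx1 z0 scale0r mul0mx => ->.
  have : eigenvalue (map_mx ratr A : 'M[algC]_n.+1) z^-1.
    apply/eigenvalueP; exists v => //; have := congr1 (mulmx^~ (map_mx ratr A)) vB.
    by rewrite -mulmxA BA mulmx1 -scalemxAl => {2}->; rewrite scalerA mulVf// scale1r.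
  move/eA; rewrite normfV => z1; rewrite -(invrK `|z|) invf_lt1//.
  by rewrite invr_gt0 normr_gt0.
have {sE} : \prod_(z <- s) (B - z%:M) = 0.
  rewrite -(Cayley_Hamilton B) sE rmorph_prod; apply: eq_bigr => z _.
  by rewrite rmorphB /= horner_mx_X horner_mx_C.
move=> sB.
have {sB s1} [C [r [C0 r0 r1 BC]]] : exists C r : algC, [/\ 0 <= C, 0 <= r, r < 1 &
    forall k i j, `|(B ^+ k) i j| <= C * r ^+ k].
  have : exists C r : algC, [/\ 0 <= C, 0 <= r, r < 1 &
    forall k i j, `|(B ^+ k * \prod_(z <- s) (B - z%:M)) i j| <= C * r ^+ k].
    exists 0, 0; split => // k i j.
    by rewrite sB mulr0 mxE normr0 mul0r.
  elim: s s1 {sB} => [|z s IH] s1.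
    by move=> [C [r [C0 r0 r1 h]]]; exists C, r; split => // k i j;
       have := h k i j; rewrite big_nil mulr1.
  move=> h; apply: IH => [w ws|]; first by apply: s1; rewrite inE ws orbT.
  apply: (@geometric_bound_step _ _ z); first by apply: s1; rewrite inE eqxx.
  move: h => [C [r [C0 r0 r1 h]]]; exists C, r; split => // k i j.
  have := h k i j; rewrite big_cons mulrA mulrBr -exprSr mulrBl.
  by rewrite -scalemx1 -scalerAr mulr1 -scalerAl mxE [X in _ + X]mxE [X in _ - X]mxE.
(* [C] and [r] live in [algC]. They are replaced by larger rational constants, the ratio 1 - 1/M
   still being below 1, so that the bound transfers to any [realType]. *)
pose M := (Num.bound (1 - r)^-1).+1.
have M0 : 0 < M%:R :> algC by rewrite ltr0n.
have r1' : 0 < 1 - r by rewrite subr_gt0.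
have rM : r <= ratr (1 - M%:R^-1).
  rewrite rmorphB rmorph1 fmorphV rmorph_nat lerBrDr -lerBrDl.
  rewrite -[leRHS]invrK lef_pV2 ?posrE ?invr_gt0//.
  apply: (@le_trans _ _ (Num.bound (1 - r)^-1)%:R); last by rewrite ler_nat.
  by apply/ltW/archi_boundP; rewrite invr_ge0 ltW.
exists (Num.bound C)%:R, (1 - M%:R^-1); split => //.
- by rewrite subr_ge0 invf_le1 ?ler1n ?ltr0n.
- by rewrite ltrBlDr ltrDl invr_gt0 ltr0n.
move=> k i j; rewrite -(ler_rat algC) ratr_norm rmorphM rmorphXn /= ratr_nat.
have -> : ratr ((A^-1 ^+ k) i j) = (B ^+ k) i j.
  by rewrite /B -rmorphXn mxE.
apply: le_trans (BC _ _ _) _; apply: ler_pM; rewrite ?exprn_ge0//.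
  by apply/ltW/archi_boundP.
by rewrite lerXn2r// nnegrE// (le_trans r0).
Qed.

(** * The lattices and the metric *)

Section LatticeFacts.
Variables (n : nat) (M : 'M[rat]_n.+1).
Implicit Types (x y : 'cV[rat]_n.+1).

Lemma ZspanB x y : Zspan M x -> Zspan M y -> Zspan M (x - y).
Proof. by move=> Mx My; apply: ZspanD => //; exact: ZspanN. Qed.

Lemma Zspan_int (z : 'cV[int]_n.+1) : Zspan M (int_col z).
Proof.
exists 1%N, (fun=> z); split => //.
by rewrite big_ord_recl big_ord0 addr0 expr0 mul1mx.
Qed.

Lemma Zspan_exp (k : nat) x : Zspan M x -> Zspan M (M ^+ k *m x).
Proof.
move=> Mx; elim: k => [|k IH]; first by rewrite expr0 mul1mx.
by rewrite exprS -mulmxE -mulmxA; exact: Zspan_mul.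
Qed.

(** [Zindex] is 0 for an infinite quotient, so its positivity supplies finiteness; [r i] is a point
    of the i-th coset. *)
Lemma Zindex_reps : (0 < Zindex M)%N ->
  exists r : 'I_(Zindex M) -> 'cV[rat]_n.+1,
  [/\ forall i, Zspan M (r i),
      forall x, Zspan M x -> exists i y, Zspan M y /\ x = r i + M *m y &
      forall i j y, Zspan M y -> r i = r j + M *m y -> i = j].
Proof.
rewrite /Zindex; set Q := (X in fset_set X) => Q0.
have finQ : finite_set Q.
  by apply: contrapT => infQ; move: Q0; rewrite /fset_set; case: pselect.
have QP (i : 'I_(#|` fset_set Q|)) : exists x, Zspan M x /\
    [set x + M *m y | y in Zspan M] = nth set0 (fset_set Q) i.
  have [x Mx xE] : Q (nth set0 (fset_set Q) i).
    by apply/set_mem; rewrite -in_fset_set// mem_nth.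
  by exists x.
have [r rP] := boolp.choice QP; exists r; split.
- by move=> i; have [] := rP i.
- move=> x Mx; pose c := [set x + M *m y | y in Zspan M]; have Qx : c \in fset_set Q.
    by rewrite in_fset_set// inE; exists x.
  have ix : (index c (fset_set Q) < #|` fset_set Q|)%N.
    by rewrite index_mem.
  exists (Ordinal ix); have [Mr] := rP (Ordinal ix).
  rewrite nth_index// => rE; have : [set r (Ordinal ix) + M *m y | y in Zspan M] x.
    by rewrite rE; exists 0; [exact: Zspan0|rewrite mulmx0 addr0].
  by move=> [y My yx]; exists y.
- move=> i j y My rij; apply/val_inj/eqP.
  rewrite -(nth_uniq set0 (ltn_ord i) (ltn_ord j) (fset_uniq (fset_set Q))).
  have [_ <-] := rP i; have [_ <-] := rP j; apply/eqP/seteqP; split=> _ [w Mw <-].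
    by exists (y + w); [exact: ZspanD|rewrite rij mulmxDr addrA].
  exists (w - y); first exact: ZspanB.
  by rewrite rij mulmxBr addrACA -addrA addrA addrC; rewrite subrr add0r addrC.
Qed.

End LatticeFacts.

Section LaurentFacts.
Variables (n : nat) (A : 'M[rat]_n.+1).
Hypothesis uA : A \is a GRing.unit.
Notation B := A^-1.

(** Exponents of B up to 0 go to [u], positive ones to [v]. Modulo Z^n[A], every element thus lies
    in Z^n[B], the unit ball; hence the cocompactness of [Gam]. *)
Lemma Zlaurent_split x : Zlaurent B x ->
  exists u v, [/\ Zspan A u, Zspan B v & x = u + v].
Proof.
move=> [k [z [k0 ->]]]; apply: (big_ind (fun x => exists u v,
    [/\ Zspan A u, Zspan B v & x = u + v])).
- by exists 0, 0; split; rewrite ?addr0//; exact: Zspan0.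
- move=> x1 x2 [u1 [v1 [u1A v1B ->]]] [u2 [v2 [u2A v2B ->]]].
  by exists (u1 + u2), (v1 + v2); split; rewrite 1?addrACA//; exact: ZspanD.
- move=> i _; have [ik|ki] := leqP i k.
    exists (A ^+ (k - i) *m int_col (z i)), 0; split.
    + exact/Zspan_exp/Zspan_int.
    + exact: Zspan0.
    + rewrite addr0; congr (_ *m _).
      by rewrite exprz_inv opprB subzn.
  exists 0, (B ^+ (i - k) *m int_col (z i)); split.
  - exact: Zspan0.
  - exact/Zspan_exp/Zspan_int.
  - by rewrite add0r subzn// ltnW.
Qed.

Lemma Zlaurent_mulV x : Zlaurent B x -> Zlaurent B (B *m x).
Proof.
move=> [k [z [k0 ->]]]; rewrite mulmx_sumr; apply: Zlaurent_sum => i _.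
rewrite mulmxA; have -> : B *m B ^ (i%:Z - k%:Z) = B ^ (1 + (i%:Z - k%:Z)).
  by rewrite [RHS]exprzDr ?unitrV// expr1z.
exact: Zlaurent_term.
Qed.

End LaurentFacts.

Section MetricFacts.
Variables (R : realType) (n : nat) (A : 'M[rat]_n.+1).
Notation B := A^-1.
Hypotheses (uA : A \is a GRing.unit) (b_gt1 : (1 < Zindex B)%N).
Let b : R := (Zindex B)%:R.

Lemma powb_expR (r : R) : powb B r%:E = expR (- r * ln b).
Proof. by rewrite /= /powR pnatr_eq0 gtn_eqF// ltnW. Qed.

Lemma ln_b_gt0 : 0 < ln b.
Proof. by rewrite ln_gt0// ltr1n. Qed.

Lemma powb_gt0 (e : \bar R) : e != +oo%E -> e != -oo%E -> 0 < powb B e.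
Proof. by case: e => // r _ _; rewrite powb_expR expR_gt0. Qed.

(** [powb] sends both infinities to 0, hence the exclusion of -oo; elsewhere [ln b > 0] makes it
    injective. *)
Lemma powb_inj (e f : \bar R) : e != -oo%E -> f != -oo%E -> powb B e = powb B f -> e = f.
Proof.
move: e f => [r| |] [s| |] // _ _ h.
- move: h; rewrite !powb_expR => /expR_inj /(mulIf (lt0r_neq0 ln_b_gt0)).
  by move/oppr_inj => ->.
- by have := @powb_gt0 r%:E isT isT; rewrite h ltxx.
- by have := @powb_gt0 s%:E isT isT; rewrite -h ltxx.
Qed.

Lemma powb_lt (e f : \bar R) : e != -oo%E -> f != -oo%E ->
  (powb B f < powb B e) = (e < f)%E.
Proof.
move=> e0 f0; apply/idP/idP => h; last first.
  rewrite lt_neqAle powb_anti ?(ltW h)// andbT; apply/eqP => fe.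
  by move: h; rewrite (powb_inj f0 e0 fe) ltxx.
by rewrite ltNge; apply: contraTN h => h; rewrite -leNgt powb_anti.
Qed.

Lemma nu_ge0P y : (0 <= nu R B y)%E <-> Zspan B y.
Proof.
split=> [|By].
  apply: contraPP => nBy; apply/negP; rewrite -ltNge.
  apply: (@le_lt_trans _ _ (-1)%:E); last by rewrite lte_fin ltrN10.
  apply: ereal_inf_lbound; exists (-1); last by rewrite intrN.
  by rewrite /= addNr expr0z => -[x Bx yE]; apply: nBy; rewrite -yE mul1mx.
apply: le_ereal_inf_tmp => _ [k nk <-]; rewrite lee_fin ler0z leNgt.
apply/negP => k0; apply: nk => /=.
pose m := absz (k + 1)%R; have mE : k + 1 = - m%:Z by rewrite /m; lia.
exists (B ^+ m *m y); first exact: Zspan_exp.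
rewrite mE exprz_inv opprK mulmxA mulmxE -[A ^ m%:Z]/(A ^+ m) exprVn.
by rewrite mulrV ?unitrX// mul1mx.
Qed.

Lemma nu_mul y : nu R B (A *m y) = (nu R B y - 1)%E.
Proof.
have E k : ~ [set B ^ (k + 1) *m x | x in Zspan B] (A *m y) <->
    ~ [set B ^ (k + 1 + 1) *m x | x in Zspan B] y.
  suff: [set B ^ (k + 1) *m x | x in Zspan B] (A *m y) <->
    [set B ^ (k + 1 + 1) *m x | x in Zspan B] y by tauto.
  have BE : B ^ (k + 1 + 1) = B *m B ^ (k + 1).
    by rewrite addrC exprzDr ?unitrV// expr1z.
  split=> -[x Bx xE]; exists x => //.
    by rewrite BE -mulmxA xE mulmxA mulmxE mulVr// mul1mx.
  by rewrite -xE BE !mulmxA !mulmxE mulrV// mul1r.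
apply/eqP; rewrite eq_le; apply/andP; split.
  rewrite leeBrDr//; apply: le_ereal_inf_tmp => _ [k nk <-].
  rewrite -leeBrDr// -EFinB; apply: ereal_inf_lbound; exists (k - 1).
    by apply/E; rewrite subrK.
  by rewrite intrB.
apply: le_ereal_inf_tmp => _ [k nk <-]; rewrite leeBlDr//.
apply: ereal_inf_lbound; exists (k + 1); first exact/E.
by rewrite intrD.
Qed.

Hypothesis uB : B \is a GRing.unit.
Notation d := (dB_pseudometric R uB b_gt1).

Lemma dB_ultra (y x z : laurent B) (e : R) : d x y <= e -> d y z <= e -> d x z <= e.
Proof.
rewrite /= /dB => xy yz.
have := nuD R B (val x - val y) (val y - val z).
rewrite addrA subrK ge_min => /orP[] h.
  by apply: le_trans xy; apply: powb_anti => //; rewrite -raddfB; exact: nu_ninfty.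
by apply: le_trans yz; apply: powb_anti => //; rewrite -raddfB; exact: nu_ninfty.
Qed.

Lemma dB_le1 (x : laurent B) : (d x 0 <= 1) <-> Zspan B (val x).
Proof.
rewrite -nu_ge0P -[d x 0]/(dB R x 0) /dB [\val 0]raddf0 subr0.
have -> : 1 = powb B (0 : R)%:E :> R by rewrite (powb_expR 0) oppr0 mul0r expR0.
by rewrite leNgt powb_lt ?nu_ninfty// -leNgt.
Qed.

Lemma dB_mul (x y x' y' : laurent B) : val x' = A *m val x -> val y' = A *m val y ->
  d x' y' = b * d x y.
Proof.
change (val x' = A *m val x -> val y' = A *m val y -> dB R x' y' = b * dB R x y).
rewrite /dB => -> ->; rewrite -mulmxBr nu_mul -raddfB.
have := nu_ninfty R uB b_gt1 (x - y); case: (nu _ _ _) => [r| |]// _.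
  rewrite -EFinB !powb_expR opprB mulrDl mul1r expRD lnK ?mulNr//.
  by rewrite posrE ltr0n ltnW.
by rewrite /= mulr0.
Qed.

End MetricFacts.

(** * Completions *)

Section CompletionFacts.
Variables (R : realType) (V : zmodType) (d : inv_pseudometric R V).
Implicit Types (x y z : completion d).

(** [cdist] is defined through the chosen representatives [rseq]; this frees it from that choice. *)
Lemma cdist_cpi (u v : nat -> V) (cu : cauchy_seq d u) (cv : cauchy_seq d v) :
  (fun i => d (u i) (v i)) @ \oo --> cdist (cpi cu) (cpi cv).
Proof.
have h : (fun i => d (u i) (v i) - d (rseq (cpi cu) i) (rseq (cpi cv) i)) @ \oo --> (0 : R).
  apply: norm_cvg0; apply: (cvg0_le _ (_ : (fun i => d (rseq (cpi cu) i) (u i) +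
      d (rseq (cpi cv) i) (v i)) @ \oo --> (0 : R))) => [i|].
    rewrite normr_ge0/=; apply: le_trans (ipm_dist2 _ _ _ _ _) _.
    by rewrite (ipm_sym d (u i)) (ipm_sym d (v i)).
  by rewrite -[0 : R]addr0; apply: cvgD; exact: rseq_cpi.
rewrite -[X in _ --> X]add0r.
under eq_fun => i do rewrite -[d (u i) (v i)](subrK (d (rseq (cpi cu) i) (rseq (cpi cv) i))).
by apply: cvgD => //; exact: cdistP.
Qed.

Lemma cdist_cpi_le (u v : nat -> V) (cu : cauchy_seq d u) (cv : cauchy_seq d v) N e :
  (forall i, (N <= i)%N -> d (u i) (v i) <= e) -> cdist (cpi cu) (cpi cv) <= e.
Proof.
move=> h; have e_cvg : (fun=> e) @ \oo --> e by exact: cvg_cst.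
apply: (ler_cvg_to (@cdist_cpi _ _ cu cv) e_cvg).
by exists N => // i /= Ni; exact: h.
Qed.

Lemma cdist_canonical (a c : V) :
  cdist (canonical_map d a) (canonical_map d c) = d a c.
Proof.
have h := @cdist_cpi _ _ (cauchy_seq_cst d a) (cauchy_seq_cst d c).
exact: (cvg_unique _ h (cvg_cst _)).
Qed.

Lemma addr_cpi (u v : nat -> V) (cu : cauchy_seq d u) (cv : cauchy_seq d v) :
  cpi cu + cpi cv = cpi (cauchy_seqD cu cv).
Proof. exact: cadd_cpi. Qed.

Lemma canonical_mapD (a c : V) :
  canonical_map d (a + c) = canonical_map d a + canonical_map d c.
Proof.
by rewrite addr_cpi; exact: cpi_ext.
Qed.

Lemma canonical_mapN (a : V) : canonical_map d (- a) = - canonical_map d a.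
Proof.
by apply/eqP; rewrite -subr_eq0 opprK -canonical_mapD addNr.
Qed.

Lemma cdistDr x y z : cdist (x + z) (y + z) = cdist x y.
Proof.
rewrite -[in LHS](cpi_rseq x) -[in LHS](cpi_rseq y) -(cpi_rseq z).
rewrite !addr_cpi.
have h := @cdist_cpi _ _ (cauchy_seqD (@rseq_cauchy _ _ d x) (@rseq_cauchy _ _ d z))
  (cauchy_seqD (@rseq_cauchy _ _ d y) (@rseq_cauchy _ _ d z)).
apply: (cvg_unique (@Rhausdorff R) h) => //=; rewrite (_ : (fun i => _) = fun i => d (rseq x i) (rseq y i)).
  exact: cdistP.
by apply/funext => i; rewrite ipm_invariant.
Qed.

Lemma cdist_sub x y : cdist (x - y) 0 = cdist x y.
Proof. by rewrite -(cdistDr _ _ y) subrK add0r. Qed.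

Lemma cdistN x : cdist (- x) 0 = cdist x 0.
Proof. by rewrite -(cdistDr _ _ x) addNr add0r cdist_sym. Qed.

Lemma cdist_ge0 x y : 0 <= cdist x y.
Proof. exact: (@mdist_ge0 R (completion d)). Qed.

Lemma canonical_dense y (e : R) : 0 < e -> exists a, cdist y (canonical_map d a) <= e.
Proof.
move=> e0; have [N yN] := @rseq_cauchy _ _ d y _ e0.
exists (rseq y N); rewrite -{1}(cpi_rseq y); apply: (@cdist_cpi_le _ _ _ _ N) => i Ni.
by apply/ltW/yN.
Qed.

Lemma cvg_canonical (u : nat -> V) (cu : cauchy_seq d u) :
  (fun i => canonical_map d (u i) : completion d) @ \oo --> cpi cu.
Proof.
apply/cvg_ballP => e e0; have e20 : 0 < e / 2 by rewrite divr_gt0.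
have [N uN] := cu _ e20; exists N => // i /= Ni.
change (is_true (cdist (cpi cu) (canonical_map d (u i)) < e)).
apply: (@le_lt_trans _ _ (e / 2)); last by rewrite gtr_pMr// invf_lt1// ltr1n.
by apply: (@cdist_cpi_le _ _ _ _ N) => j Nj; exact/ltW/uN.
Qed.

Lemma lim_canonical (u : nat -> V) (cu : cauchy_seq d u) :
  limn (fun i => canonical_map d (u i) : completion d) = cpi cu.
Proof. by apply: cvg_lim; [exact: metric_hausdorff|exact: cvg_canonical]. Qed.

Section Ultrametric.
Hypothesis d_ultra : forall (y x z : V) (e : R), d x y <= e -> d y z <= e -> d x z <= e.

Lemma cdist_ultra y x z (e : R) : cdist x y <= e -> cdist y z <= e -> cdist x z <= e.
Proof.
move=> xy yz; rewrite leNgt; apply/negP => exz.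
(* Distances along the representatives need not be at most [e], but they are eventually below any
   [e'] larger than [e]. *)
pose e' := (e + cdist x z) / 2.
have ee' : e < e' by rewrite /e' midf_lt.
have e'xz : e' < cdist x z by rewrite /e' midf_lt.
suff : cdist x z <= e' by rewrite leNgt e'xz.
have e_cvg : (fun=> e') @ \oo --> e' by exact: cvg_cst.
apply: (ler_cvg_to (@cdistP _ _ d x z) e_cvg).
near=> i; apply: (@d_ultra (rseq y i)); apply: ltW; near: i.
  by apply: (cvgr_lt (cdist x y)); [exact: cdistP|exact: le_lt_trans ee'].
by apply: (cvgr_lt (cdist y z)); [exact: cdistP|exact: le_lt_trans ee'].
Unshelve. all: by end_near. Qed.

End Ultrametric.

Section Extension.
Variables (f : V -> V) (b : R).
Hypothesis b0 : 0 < b.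
Hypothesis fb : forall a c, d (f a) (f c) = b * d a c.

Lemma cauchy_seq_dilation (u : nat -> V) : cauchy_seq d u -> cauchy_seq d (f \o u).
Proof.
move=> cu e e0; have [N uN] := cu _ (divr_gt0 e0 b0).
by exists N => i j Ni Nj; rewrite /= fb mulrC -ltr_pdivlMr//; exact: uN.
Qed.

(** The termwise action on a representative; [lim_cext] identifies it with a limit of the form that
    defines [mul_completion]. *)
Definition cext y : completion d := cpi (cauchy_seq_dilation (@rseq_cauchy _ _ d y)).

Lemma cext_cpi (u : nat -> V) (cu : cauchy_seq d u) :
  cext (cpi cu) = cpi (cauchy_seq_dilation cu).
Proof.
apply: cpi_eq; under eq_fun do rewrite /= fb.
by rewrite -(mulr0 b); apply: cvgM; [exact: cvg_cst|exact: rseq_cpi].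
Qed.

Lemma cdist_cext x y : cdist (cext x) (cext y) = b * cdist x y.
Proof.
apply: (cvg_unique (@Rhausdorff R) (@cdist_cpi _ _ _ _)) => //=.
rewrite (_ : (fun i => _) = fun i => b * d (rseq x i) (rseq y i)).
  by apply: cvgM; [exact: cvg_cst|exact: cdistP].
by apply/funext => i; rewrite /= fb.
Qed.

Lemma cext_canonical (a : V) : cext (canonical_map d a) = canonical_map d (f a).
Proof. by rewrite cext_cpi; exact: cpi_ext. Qed.

Lemma lim_cext y : limn (fun i => canonical_map d (f (rseq y i)) : completion d) = cext y.
Proof. exact: lim_canonical. Qed.

Lemma cextD x y : (forall a c, f (a + c) = f a + f c) -> cext (x + y) = cext x + cext y.
Proof.
move=> fD; rewrite -{1}(cpi_rseq x) -{1}(cpi_rseq y).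
rewrite addr_cpi cext_cpi [RHS]addr_cpi.
by apply: cpi_ext => i /=; exact: fD.
Qed.

End Extension.

End CompletionFacts.

(** * Measures *)

Section LebesgueTranslation.
Variable R : realType.

Lemma lebesgue_measure_shift (a : R) (E : set (measurableTypeR R)) : measurable E ->
  lebesgue_measure ((fun x => x + a) @^-1` E) = lebesgue_measure E.
Proof.
move=> mE.
have ma : measurable_fun [set: measurableTypeR R] (fun x : measurableTypeR R => x + a : measurableTypeR R).
  exact: measurable_funD.
pose mu := measure_function_pushforward__canonical__measure_function_Measure
  (@lebesgue_measure R) ma.
rewrite [RHS](@lebesgue_measure_unique R mu)// => _ [[b c] _ <-].
rewrite /mu/= /pushforward.
have -> : (fun x => x + a) @^-1` `]b, c] = `]b - a, c - a]%classic.
  by apply/seteqP; split=> x /=; rewrite !in_itv/= ltrBlDr lerBrDr.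
by rewrite !lebesgue_measure_itv /= !lte_fin ltrD2r -!EFinB opprB addrA subrK.
Qed.

Lemma measurable_col_shift n (t : 'cV[R]_n) :
  measurable_fun [set: 'cV[R]_n] (fun x : 'cV[R]_n => x + t).
Proof.
apply: measurable_fun_colP => i; under eq_fun do rewrite mxE.
by apply: measurable_funD => //; exact: measurable_col_coord.
Qed.

(** The shift acts fibrewise: the section at x is a one-dimensional shift of the section at x + t'.
    The shift of the base is then a change of variables, harmless by induction. *)
Lemma lebesgueN_shift n (t : 'cV[R]_n) (E : set 'cV[R]_n) : measurable E ->
  lebesgueN R n ((fun x => x + t) @^-1` E) = lebesgueN R n E.
Proof.
elim: n t E => [|n IH] t E mE.
  congr (lebesgueN R 0 _); apply/seteqP.
  by split=> x /=; rewrite (flatmx0 x) (flatmx0 (_ + _)).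
pose t0 : R := t ord0 ord0.
pose t' : 'cV[R]_n := \col_i t (lift ord0 i) ord0.
pose E' := @cons_col R n @^-1` E.
have mE' : measurable E' by rewrite -[E']setTI; exact: measurable_cons_col.
pose E1 := @cons_col R n @^-1` ((fun x => x + t) @^-1` E).
have E'x x : xsection E1 x =
    (fun r => r + t0) @^-1` xsection E' (x + t').
  apply/seteqP; split=> r; rewrite /xsection/= !inE /E' /E1 /=.
    suff -> : cons_col (x, r) + t = cons_col (x + t', r + t0) by [].
    by apply/colP => i; rewrite !mxE; case: unliftP => [j|] ->; rewrite //= !mxE.
  suff -> : cons_col (x, r) + t = cons_col (x + t', r + t0) by [].
  by apply/colP => i; rewrite !mxE; case: unliftP => [j|] ->; rewrite //= !mxE.
change ((\int[lebesgueN R n]_x lebesgue_measure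
  (xsection E1 x) =
  \int[lebesgueN R n]_x lebesgue_measure (xsection E' x))%E).
under eq_integral => x _.
  rewrite E'x lebesgue_measure_shift; last exact: measurable_xsection.
  over.
pose g x := lebesgue_measure (xsection E' x).
have mt' := measurable_col_shift t'.
transitivity (\int[pushforward (lebesgueN R n) (fun x => (x + t')%R)]_x g x)%E.
  by rewrite [RHS]ge0_integral_pushforward//; exact: measurable_fun_xsection.
apply: eq_measure_integral => /= A mA _; exact: IH.
Qed.

End LebesgueTranslation.

Section BoxMeasure.
Variable R : realType.

Lemma measurable_col_box n (r : R) :
  measurable [set x : 'cV[R]_n | forall i, `|x i ord0| <= r].
Proof.
have -> : [set x : 'cV[R]_n | forall i, `|x i ord0| <= r] =
    \bigcap_(i in [set: 'I_n]) ((fun x : 'cV[R]_n => x i ord0) @^-1` `[- r, r]%classic).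
  apply/seteqP; split=> x /= h i; first by move=> _; rewrite /= in_itv/= -ler_norml.
  by have := h i I; rewrite /= in_itv/= -ler_norml.
apply: fin_bigcap_measurable => // i _; rewrite -[X in measurable X]setTI.
exact: measurable_col_coord.
Qed.

Lemma lebesgueN_box n (r : R) :
  (lebesgueN R n [set x | forall i, (`|x i ord0| <= r)%R] < +oo)%E.
Proof.
elim: n => [|n IH]; first by rewrite /= diracE ltry.
change ((lebesgueN R n \x (@lebesgue_measure R)) (@cons_col R n @^-1`
  [set x : 'cV[R]_n.+1 | forall i, (`|x i ord0| <= r)%R]) < +oo)%E.
rewrite [X in (_ \x _)%E X](_ : _ =
  [set x : 'cV[R]_n | forall i, (`|x i ord0| <= r)%R] `*` `[- r, r]%classic).
  rewrite product_measure1E//; last exact: measurable_col_box.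
  apply: lte_mul_pinfty => //; first by rewrite ge0_fin_numE.
  have h : (lebesgue_measure (`[(- r)%R, r]%classic : set R) < +oo)%E.
    by rewrite lebesgue_measure_itv /=; case: ifP => _; rewrite ltry.
  exact: h.
apply/seteqP; split=> -[x s] /= h.
  split; last by have := h ord0; rewrite mxE unlift_none /= in_itv/= -ler_norml.
  by move=> i; have := h (lift ord0 i); rewrite mxE liftK.
move=> i; rewrite mxE; case: unliftP => [j _|_] /=; first exact: h.1.
by have := h.2; rewrite in_itv/= -ler_norml.
Qed.

End BoxMeasure.

(** * Open sets of the product and their measurability *)

Section ProductTopology.
Variables (R : realType) (n : nat) (V : zmodType) (d : inv_pseudometric R V).
Notation G := ('cV[R]_n.+1 * completion d)%type.

Lemma open_boxP (W : set G) : open W <->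
  (forall p, W p -> exists2 e : R, 0 < e & forall q : G,
    (forall i, `|q.1 i ord0 - p.1 i ord0| < e) -> cdist q.2 p.2 < e -> W q).
Proof.
rewrite openE; split=> [oW p Wp|h p /h[e e0 eW]].
  have /nbhs_ballP[e /= e0 eW] := oW _ Wp.
  exists e => // q q1 q2; apply: eW; split.
    by split=> // i j; rewrite (ord1 j) /ball/= distrC.
  by rewrite cdist_sym in q2.
apply/nbhs_ballP; exists e => //= q [[_ q1] q2]; apply: eW.
  by move=> i; have := q1 i ord0; rewrite /ball/= distrC.
by rewrite cdist_sym.
Qed.

Lemma open_cball (c : completion d) (e : R) : open [set v | cdist v c < e].
Proof.
rewrite openE => v /= ve; apply/nbhs_ballP; exists (e - cdist v c).
  by rewrite /= subr_gt0.
move=> w; change (is_true (cdist v w < e - cdist v c) -> is_true (cdist w c < e)).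
rewrite ltrBrDr (cdist_sym v w); exact/le_lt_trans/cdist_triangle.
Qed.

Hypothesis cV : countable [set: V].

(** Second countability puts open sets into the product sigma-algebra: an open set is the union of
    the boxes inside it with rational centre in the first factor, centre from the countable [V] in
    the second, and radius 1/(m+1). *)
Lemma measurable_open_prod (W : set G) : open W -> measurable W.
Proof.
move=> /open_boxP oW.
pose B (t : 'cV[rat]_n.+1 * V * nat) : set G :=
  [set u : 'cV[R]_n.+1 | forall i, `|u i ord0 - ratr (t.1.1 i ord0)| < t.2.+1%:R^-1] `*`
  [set v | cdist v (canonical_map d t.1.2) < t.2.+1%:R^-1].
pose B' t := if pselect (B t `<=` W) then B t else set0.
have -> : W = \bigcup_t B' t.
  apply/seteqP; split=> [p /oW[e e0 eW]|p [t _]]; last first.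
    by rewrite /B'; case: pselect => // tW /tW.
  have [m me] : exists m : nat, m.+1%:R^-1 < e / 2.
    have := @near_infty_natSinv_lt R (PosNum (divr_gt0 e0 (@ltr0Sn R 1))).
    by move=> [m _ /(_ m (leqnn m))]; exists m.
  have m0 : 0 < m.+1%:R^-1 :> R by rewrite invr_gt0.
  have hq i : exists q : rat, `|p.1 i ord0 - ratr q| < m.+1%:R^-1.
    have itv_ne : p.1 i ord0 - m.+1%:R^-1 < p.1 i ord0 + m.+1%:R^-1.
      by rewrite ltrBlDr -addrA ltrDl addr_gt0.
    have [q] := rat_in_itvoo itv_ne.
    rewrite in_itv/= => /andP[q1 q2]; exists q.
    by rewrite ltr_norml ltrBrDr addrC ltrBlDr q2 /= ltrBlDr addrC -ltrBlDr q1.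
  have {hq} [q qP] := boolp.choice hq.
  have [a ha] := @canonical_dense _ _ d p.2 (m.+1%:R^-1 / 2) (divr_gt0 m0 (@ltr0Sn R 1)).
  pose t := (\col_i q i, a, m).
  have Bp : B t p.
    split=> [i|] /=; first by rewrite mxE.
    by apply: le_lt_trans ha _; rewrite gtr_pMr// invf_lt1// ltr1n.
  exists t => //; rewrite /B'; case: pselect => // nBW; exfalso; apply: nBW.
  move=> w [/= w1 w2]; apply: eW => [i|].
    have := ltrD (w1 i) (qP i); rewrite mxE => h.
    apply: (@le_lt_trans _ _ (`|w.1 i ord0 - ratr (q i)| + `|p.1 i ord0 - ratr (q i)|)).
      rewrite (distrC (p.1 _ _)); apply: le_trans (ler_normD _ _).
      by rewrite addrA subrK.
    apply: lt_trans h _; rewrite [ltRHS]splitr; exact: ltrD.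
  apply: le_lt_trans (cdist_triangle (canonical_map d a) _ _) _.
  rewrite [ltRHS]splitr ltrD//; first exact: lt_trans me.
  rewrite cdist_sym; apply: le_lt_trans ha _; apply: lt_trans me.
  by rewrite gtr_pMr// invf_lt1// ltr1n.
apply: countable_bigcupT_measurable.
  by rewrite -!setXTT; apply: countableX; [apply: countableX|].
move=> t; rewrite /B'; case: pselect => //= tW; apply: measurableX.
  have -> : [set u : 'cV[R]_n.+1 | forall i, `|u i ord0 - ratr (t.1.1 i ord0)| < t.2.+1%:R^-1] =
     \bigcap_(i in [set: 'I_n.+1]) ((fun x : 'cV[R]_n.+1 => x i ord0) @^-1`
       ball (ratr (t.1.1 i ord0) : R) t.2.+1%:R^-1).
    apply/seteqP; split=> x /= h i; first by move=> _; rewrite /ball/= distrC.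
    by have := h i I; rewrite /ball/= distrC.
  apply: fin_bigcap_measurable => // i _; rewrite -[X in measurable X]setTI.
  by apply: measurable_col_coord => //; exact: measurable_ball.
apply: sub_sigma_algebra.
exact: open_cball.
Qed.

End ProductTopology.

(* The cells Q k i that meet E decrease to E, while each of them loses a fixed
   proportion of its measure to a part c k i outside E. *)
Lemma null_of_cells dd (T : measurableType dd) (R : realType)
    (mu : {measure set T -> \bar R}) (E : set T) (N : nat) (D : set nat)
    (c Q : nat -> nat -> set T) :
  measurable E -> (forall k i, measurable (c k i)) -> (forall k i, measurable (Q k i)) ->
  (forall k, E `<=` \bigcup_(i in D) Q k i) ->
  (forall k i, (mu (Q k i) <= N%:R%:E * mu (c k i))%E) ->
  (forall k, trivIset D (c k)) ->
  (forall k i, D i -> c k i `&` E = set0) ->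
  (forall k i, c k i `<=` Q k i) ->
  let S k := \bigcup_(j in [set j | (k <= j)%N])
    \bigcup_(i in [set i | D i /\ Q j i `&` E !=set0]) Q j i in
  \bigcap_k S k `<=` E -> (exists k, (mu (S k) < +oo)%E) -> mu E = 0.
Proof.
move=> mE mc mQ EQ Qc tc cE cQ S SE [k0 Sfin].
have mS k : measurable (S k).
  by apply: bigcup_measurable => j _; apply: bigcup_measurable => i _; exact: mQ.
(* [S k] gathers all scales from k on, because cells of successive scales need not be nested. *)
have Snd k l : (k <= l)%N -> S l `<=` S k.
  by move=> kl p [j /= lj Qj]; exists j => //=; exact: leq_trans lj.
(* For the cells meeting E, the parts [c k i] are disjoint, lie in [S k] and miss E, so their total
   measure is at most that of [S k] minus E. These differences decrease to the empty set. *)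
have bound k : (mu E <= N%:R%:E * mu (S k `\` E))%E.
  pose Dk := [set i | D i /\ Q k i `&` E !=set0].
  have tck : trivIset Dk (c k) by apply: sub_trivIset (tc k) => i [].
  apply: (@le_trans _ _ (\sum_(i <oo | i \in Dk) mu (Q k i))%E).
    rewrite [leRHS]eseries_mkcond.
    pose Q' i := if i \in Dk then Q k i else set0.
    apply: (@le_trans _ _ (\sum_(i <oo) mu (Q' i))%E).
      apply: measure_sigma_subadditive => //.
        by move=> i; rewrite /Q'; case: ifP.
      move=> p Ep; have [i Di Qp] := EQ k p Ep; exists i => //.
      by rewrite /Q' ifT// inE; split=> //; exists p.
    by apply: lee_nneseries => // i _; rewrite /Q'; case: ifP; rewrite ?measure0.
  apply: (@le_trans _ _ (\sum_(i <oo | i \in Dk) N%:R%:E * mu (c k i))%E).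
    by apply: lee_nneseries => // i _; exact: Qc.
  rewrite nneseriesZl//; apply: lee_wpmul2l; first by rewrite lee_fin.
  rewrite -measure_bigcup//; apply: le_measure.
  - by rewrite inE; exact: bigcup_measurable.
  - by rewrite inE; exact: measurableD.
  - move=> p [i [Di Qi] cp]; split.
      by exists k => //=; exists i => //; exact: cQ.
    by move=> Ep; have : (c k i `&` E) p by []; rewrite cE.
apply/eqP; rewrite eq_le measure_ge0 andbT.
(* Continuity from above needs a first set of finite measure, hence the start at [k0]. *)
pose F k := S (k0 + k)%N `\` E.
have Fcvg : mu \o F @ \oo --> mu (\bigcap_k F k).
  apply: nonincreasing_cvg_mu.
  - apply: le_lt_trans Sfin; rewrite /F addn0; apply: le_measure; rewrite ?inE//.
      exact: measurableD.
  - by move=> k; exact: measurableD.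
  - by apply: bigcapT_measurable => k; exact: measurableD.
  - move=> k l kl; apply/subsetPset; apply: setSD; apply: Snd.
    by rewrite leq_add2l.
have F0 : \bigcap_k F k = set0.
  apply/seteqP; split=> // p Fp; have [] := Fp 0%N I => _; apply.
  apply: SE => k _; have [+ _] := Fp k I; apply: Snd; exact: leq_addl.
rewrite F0 measure0 in Fcvg.
have NFcvg : (fun k => N%:R%:E * mu (F k))%E @ \oo --> (0 : \bar R).
  by rewrite -(mule0 N%:R%:E); apply: cvgeZl.
have cE0 : (fun=> mu E) @ \oo --> mu E by exact: cvg_cst.
rewrite -(cvg_lim _ cE0)// -(cvg_lim _ NFcvg)//; apply: lee_lim.
- by apply/cvg_ex; exists (mu E).
- by apply/cvg_ex; exists 0%E.
- by near=> k; exact: bound.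
Unshelve. all: by end_near. Qed.

(** * The counting function *)

Section Counting.
Variables (G : zmodType) (Gam : set G) (M T : G -> G) (F : set G) (D : {fset G}).
Variables (a : nat) (r : 'I_a -> G).
Hypothesis GamD : forall x y, Gam x -> Gam y -> Gam (x + y).
Hypothesis GamN : forall x, Gam x -> Gam (- x).
Hypothesis MD : forall x y, M (x + y) = M x + M y.
Hypothesis TD : forall x y, T (x + y) = T x + T y.
Hypothesis MT : cancel T M.
Hypothesis TM : cancel M T.
Hypothesis GamM : forall x, Gam x -> Gam (M x).
Hypothesis Gamr : forall i, Gam (r i).
Hypothesis r_cover : forall x, Gam x -> exists i y, Gam y /\ x = r i + M y.
Hypothesis r_distinct : forall i j y, Gam y -> r i = r j + M y -> i = j.
Hypothesis GamDig : forall d, d \in D -> Gam d.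
Hypothesis cardD : (#|` D| <= a)%N.
Hypothesis MF : forall f, F f -> exists d f', [/\ d \in D, F f' & M f = f' + d].

Definition incidence (p : G) : set G := [set g | Gam g /\ F (p - g)].

Definition multiplicity (p : G) : nat := #|` fset_set (incidence p)|.

Hypothesis fin_inc : forall p, finite_set (incidence p).

Let MN x : M (- x) = - M x.
Proof.
have M0 : M 0 = 0 by apply: (addrI (M 0)); rewrite -MD !addr0.
by apply/eqP; rewrite -addr_eq0 -MD addNr M0.
Qed.

Let TN x : T (- x) = - T x.
Proof.
have T0 : T 0 = 0 by apply: (addrI (T 0)); rewrite -TD !addr0.
by apply/eqP; rewrite -addr_eq0 -TD addNr T0.
Qed.

Lemma in_incidence p g : (g \in fset_set (incidence p)) <-> Gam g /\ F (p - g).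
Proof. by rewrite in_fset_set//; split=> [/set_mem|/mem_set]. Qed.

Lemma multiplicity_shift p s : Gam s -> multiplicity (p - s) = multiplicity p.
Proof.
move=> Gs; rewrite /multiplicity.
have -> : fset_set (incidence p) = [fset (g + s)%R | g in fset_set (incidence (p - s))]%fset.
  apply/fsetP => g; apply/idP/imfsetP => /=.
    move=> /in_incidence[Gg Fg]; exists (g - s); last by rewrite subrK.
    by apply/in_incidence; split; [exact/GamD/GamN|rewrite opprB addrA subrK].
  move=> [h /in_incidence[Gh Fh] ->]; apply/in_incidence.
  by split; [exact: GamD|rewrite opprD addrA addrAC].
by rewrite card_imfset//; exact: addIr.
Qed.

(* Every g with T (q - g) in F gives a digit d with g + d incident to q, and
   (g + d, d) determines g. *)
Lemma sum_multiplicity q :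
  (\sum_i multiplicity (T (q - r i)) <= a * multiplicity q)%N.
Proof.
have hd (f : G) : exists d, F f -> d \in D /\ F (M f - d).
  have [Ff|nF] := pselect (F f); last by exists 0.
  have [d [f' [dD Ff' E]]] := MF Ff; exists d => _; split=> //.
  by rewrite E addrK.
have [dig digP] := boolp.choice hd.
pose J i := fset_set (incidence (T (q - r i))).
(* A pair (i, s) encodes g = r_i + M s, for which T (q - r_i) - s = T (q - g). *)
pose L := [seq (i, s) | i <- enum 'I_a, s <- enum_fset (J i)].
pose dg (u : 'I_a * G) := dig (T (q - r u.1) - u.2).
pose h (u : 'I_a * G) := (r u.1 + M u.2 + dg u, dg u).
have LP u : u \in L -> Gam u.2 /\ F (T (q - r u.1) - u.2).
  by move=> /allpairsPdep[i [s [_ sJ ->]]]; exact/in_incidence.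
have uL : uniq L.
  apply: allpairs_uniq_dep; [exact: enum_uniq|by move=> i _; exact: fset_uniq|].
  by move=> [i s] [j t] _ _ /= [-> ->].
have h_inj : {in L &, injective h}.
  move=> [i s] [j t] /LP/= [Gs _] /LP/= [Gt _] [+ dd]; rewrite /= dd => /addIr E.
  have ij : i = j.
    apply: (r_distinct (y := t - s)); first exact/GamD/GamN.
    by rewrite MD MN addrA -E addrK.
  by move: E; rewrite ij => /addrI /(can_inj TM) ->.
have hL : {subset map h L <= [seq (g, d) | g <- fset_set (incidence q), d <- D]}.
  move=> _ /mapP[[i s] /LP/= [Gs Fs] ->].
  have [dD Fd] := digP _ Fs; apply/allpairsP; exists (h (i, s)) => /=; split=> //.
  apply/in_incidence; split; first by apply: GamD; [exact/GamD/GamM|exact: GamDig].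
  move: Fd; rewrite MD MN MT; congr F.
  by rewrite !opprD !addrA.
have := uniq_leq_size _ hL; rewrite map_inj_in_uniq// => /(_ uL).
rewrite size_map size_allpairs_dep sumnE big_map big_enum /= size_allpairs => h1.
by apply: leq_trans h1 _; rewrite mulnC leq_mul2r cardD orbT.
Qed.

(** The a values at T (q - r_i) are at least m and sum to at most a m, so none exceeds m. A general
    g = r_i + M s gives T (q - g) = T (q - r_i) - s, which has the same multiplicity as T (q -
    r_i). *)
Lemma multiplicity_descent m q g : (forall p, (m <= multiplicity p)%N) ->
  (multiplicity q <= m)%N -> Gam g -> (multiplicity (T (q - g)) <= m)%N.
Proof.
move=> hm qm Gg; have [i [s [Gs gE]]] := r_cover Gg.
rewrite gE opprD addrA TD TN TM (multiplicity_shift _ Gs).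
have a0 : (0 < a)%N by apply: leq_ltn_trans (ltn_ord i).
have := leq_trans (sum_multiplicity q) (leq_mul (leqnn a) qm).
rewrite (bigD1 i)//=.
have : (\sum_(j < a | j != i) m <= \sum_(j < a | j != i) multiplicity (T (q - r j)))%N.
  exact: leq_sum.
rewrite sum_nat_const cardC1 card_ord => h1 h2.
have := leq_trans (leq_add (leqnn _) h1) h2.
by case: (a) a0 => // k _; rewrite mulSn leq_add2r.
Qed.

End Counting.

(** * The representation space *)

Section RepresentationSpace.
Variables (R : realType) (n : nat) (A : 'M[rat]_n.+1).
Hypotheses (eA : expanding A) (b_ge2 : (2 <= Zindex A^-1)%N).
Notation B := A^-1.
Notation uA := (expanding_unit eA).
Notation uB := (Defs.uB_subproof eA).
Notation d := (dB_pseudometric R uB b_ge2).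
Notation Y := (completion d).
Notation G := ('cV[R]_n.+1 * Y)%type.
Notation phi := (phi R eA b_ge2 : laurent B -> G).
Local Notation b := ((Zindex B)%:R : R).

Let b_gt1 : 1 < b. Proof. by rewrite ltr1n. Qed.
Let b_gt0 : 0 < b. Proof. exact: lt_trans b_gt1. Qed.
Let bV_gt0 : 0 < b^-1. Proof. by rewrite invr_gt0. Qed.

Lemma laurent_div_subproof (x : laurent B) : B *m val x \in laurent_pred B.
Proof. by apply/asboolP/Zlaurent_mulV; [exact: uA|exact/asboolP/(valP x)]. Qed.

Definition laurent_div (x : laurent B) : laurent B :=
  Laurent (laurent_div_subproof x).

Lemma laurent_mulK : cancel (laurent_mul eA) laurent_div.
Proof.
by move=> x; apply: val_inj; rewrite /= mulmxA mulmxE mulVr ?uA// mul1mx.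
Qed.

Lemma laurent_divK : cancel laurent_div (laurent_mul eA).
Proof.
by move=> x; apply: val_inj; rewrite /= mulmxA mulmxE mulrV ?uA// mul1mx.
Qed.

Lemma d_laurent_mul (x y : laurent B) :
  d (laurent_mul eA x) (laurent_mul eA y) = b * d x y.
Proof. by apply: dB_mul => //; exact: uA. Qed.

Lemma d_laurent_div (x y : laurent B) :
  d (laurent_div x) (laurent_div y) = b^-1 * d x y.
Proof.
by rewrite -{2}(laurent_divK x) -{2}(laurent_divK y) d_laurent_mul mulKf// gt_eqF.
Qed.

Definition mulY : Y -> Y := cext b_gt0 d_laurent_mul.
Definition divY : Y -> Y := cext bV_gt0 d_laurent_div.

Lemma mul_completionE (y : Y) : @mul_completion R n A eA b_ge2 y = mulY y.
Proof. exact: (lim_cext b_gt0 d_laurent_mul). Qed.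

Lemma mulYK : cancel mulY divY.
Proof.
move=> y; rewrite -(cpi_rseq y) /mulY (cext_cpi b_gt0 d_laurent_mul) /divY cext_cpi.
by apply: cpi_ext => i /=; rewrite laurent_mulK.
Qed.

Lemma divYK : cancel divY mulY.
Proof.
move=> y; rewrite -(cpi_rseq y) /divY (cext_cpi bV_gt0 d_laurent_div) /mulY cext_cpi.
by apply: cpi_ext => i /=; rewrite laurent_divK.
Qed.

Lemma mulYD (x y : Y) : mulY (x + y) = mulY x + mulY y.
Proof. by apply: cextD => u v; apply: val_inj; rewrite /= mulmxDr. Qed.

Lemma divYD (x y : Y) : divY (x + y) = divY x + divY y.
Proof. by apply: cextD => u v; apply: val_inj; rewrite /= mulmxDr. Qed.

Definition dilation (p : G) : G := (map_mx ratr A *m p.1, mulY p.2).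
Definition contraction (p : G) : G := (map_mx ratr B *m p.1, divY p.2).

Lemma dilD p q : dilation (p + q) = dilation p + dilation q.
Proof. by rewrite /dilation /= mulmxDr mulYD. Qed.

Lemma conD p q : contraction (p + q) = contraction p + contraction q.
Proof. by rewrite /contraction /= mulmxDr divYD. Qed.

Lemma dilK : cancel dilation contraction.
Proof.
move=> [x y]; rewrite /dilation /contraction /= mulYK mulmxA -map_mxM mulmxE.
by rewrite mulVr ?uA// map_mx1 mul1mx.
Qed.

Lemma conK : cancel contraction dilation.
Proof.
move=> [x y]; rewrite /dilation /contraction /= divYK mulmxA -map_mxM mulmxE.
by rewrite mulrV ?uA// map_mx1 mul1mx.
Qed.

Lemma dil_phi x : dilation (phi x) = phi (laurent_mul eA x).
Proof. by rewrite /dilation /Defs.phi /= -map_mxM /mulY cext_canonical. Qed.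

Lemma phiD x y : phi (x + y) = phi x + phi y.
Proof. by rewrite /Defs.phi [\val (x + y)]raddfD map_mxD canonical_mapD. Qed.

Lemma phiN x : phi (- x) = - phi x.
Proof. by rewrite /Defs.phi [\val (- x)]raddfN map_mxN canonical_mapN. Qed.

Lemma phi0 : phi 0 = 0.
Proof. by rewrite -(subrr 0) phiD phiN subrr. Qed.

Lemma phi_inj : injective phi.
Proof.
move=> x y [/map_mx_inj h _]; apply: val_inj; apply: h.
Qed.

(** * The group Gam: discreteness, cocompactness, finite index *)

Definition Gam : set G := phi @` [set x | Zspan A (val x)].

Lemma Gam0 : Gam 0.
Proof. by exists 0; [change (Zspan A (val (0 : laurent B))); rewrite raddf0; exact: Zspan0|exact: phi0]. Qed.

Lemma GamD p q : Gam p -> Gam q -> Gam (p + q).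
Proof.
move=> [x /= Ax <-] [y /= Ay <-]; exists (x + y); last exact: phiD.
by change (Zspan A (val (x + y))); rewrite raddfD; exact: ZspanD.
Qed.

Lemma GamN p : Gam p -> Gam (- p).
Proof.
move=> [x /= Ax <-]; exists (- x); last exact: phiN.
by change (Zspan A (val (- x))); rewrite raddfN; exact: ZspanN.
Qed.

Lemma GamM p : Gam p -> Gam (dilation p).
Proof.
by move=> [x /= Ax <-]; exists (laurent_mul eA x); [exact: Zspan_mul|rewrite dil_phi].
Qed.

Lemma countable_laurent : countable [set: laurent B].
Proof.
apply/countable_injP; exists (fun x => choice.pickle (val x)) => x y _ _.
by move/(pcan_inj choice.pickleK)/val_inj.
Qed.

Lemma d_le1 (x : laurent B) : d x 0 <= 1 <-> Zspan B (val x).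
Proof. by apply: dB_le1; exact: uA. Qed.

Lemma cdistY_ultra (y x z : Y) (e : R) :
  cdist x y <= e -> cdist y z <= e -> cdist x z <= e.
Proof. by apply: cdist_ultra => u v w f; exact: dB_ultra. Qed.

Lemma cdist_mulY (x y : Y) : cdist (mulY x) (mulY y) = b * cdist x y.
Proof. exact: cdist_cext. Qed.

Lemma cdist_divY (x y : Y) : cdist (divY x) (divY y) = b^-1 * cdist x y.
Proof. exact: cdist_cext. Qed.

(** A second coordinate in the unit ball puts x into Z^n[B]. Then N x is integral, with entries
    below 1 in absolute value once those of x are below 1/N. *)
Lemma Gam_discrete : exists2 e : R, 0 < e & forall g, Gam g ->
  (forall i, `|g.1 i ord0| < e) -> cdist g.2 0 <= 1 -> g = 0.
Proof.
have [N N0 hN] := bounded_denominators uA.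
have NR0 : 0 < N%:R :> R by rewrite ltr0n.
exists N%:R^-1; first by rewrite invr_gt0.
move=> _ [x /= Ax <-] x1; rewrite -[0]/(canonical_map d 0) cdist_canonical => /d_le1 Bx.
have [w wE] := hN _ Ax Bx.
suff x0 : x = 0 by rewrite x0 phi0.
apply: val_inj; rewrite raddf0.
have w0 : w = 0.
  apply/colP => i; rewrite mxE; apply/eqP; rewrite -normr_le0 -ltzD1 add0r.
  have := x1 i; rewrite mxE -(ltr_pM2l NR0) mulfV ?gt_eqF// => h.
  rewrite -(ltr_int R) intr_norm.
  have -> : (w i 0)%:~R = ratr (N%:R * (val x) i ord0) :> R.
    have /colP/(_ i) := wE; rewrite !mxE => ->.
    by rewrite ratr_int.
  by rewrite rmorphM /= ratr_nat normrM gtr0_norm.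
by move: wE; rewrite w0 int_col0 => /eqP; rewrite scaler_eq0 pnatr_eq0 gtn_eqF//= => /eqP.
Qed.

Lemma d_sub (x y : laurent B) : d x y = d (x - y) 0.
Proof. by rewrite -(ipm_invariant d _ 0 y) subrK add0r. Qed.

(** The Z^n[A] part of an approximation of [p.2] is subtracted first. The real coordinates are then
    corrected by an integer vector, which lies in Z^n[B] too and so keeps the second coordinate in
    the unit ball. *)
Lemma Gam_cover_unit (p : G) : exists2 g, Gam g &
  (forall i, 0 <= (p - g).1 i ord0 < 1) /\ cdist (p - g).2 0 <= 1.
Proof.
have [a pa] := @canonical_dense _ _ d p.2 1 ltr01.
have /asboolP/Zlaurent_split[u [v [Au Bv auv]]] := valP a.
have Lu : u \in laurent_pred B by apply/asboolP/Zspan_Zlaurent => //; exact: uA.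
pose z : 'cV[int]_n.+1 := \col_i Num.floor (p.1 i ord0 - ratr (u i ord0)).
have Lz : int_col z \in laurent_pred B.
  by apply/asboolP/Zspan_Zlaurent; [exact: uA|exact: Zspan_int].
pose x := Laurent Lu + Laurent Lz : laurent B.
have vx : val x = u + int_col z by rewrite raddfD.
exists (phi x).
  exists x => //; change (Zspan A (val x)); rewrite vx.
  by apply: ZspanD => //; exact: Zspan_int.
split.
  move=> i; have -> : (p - phi x).1 i ord0 =
      p.1 i ord0 - ratr (u i ord0) - (z i ord0)%:~R.
    rewrite -[(p - phi x).1]/(p.1 - (phi x).1) mxE [X in _ + X]mxE /Defs.phi.
    rewrite [X in _ - X]mxE vx mxE [X in ratr (_ + X)]mxE rmorphD /= ratr_int.
    by rewrite opprD addrA.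
  by rewrite mxE subr_ge0 ltrBlDl ge_floor -intrD1 floorD1_gt.
rewrite -[(p - phi x).2]/(p.2 - (phi x).2) cdist_sub.
apply: (cdistY_ultra pa); rewrite cdist_canonical d_sub; apply/d_le1.
have -> : val (a - x) = val a - val x by exact: raddfB.
rewrite vx auv opprD addrA [u + v]addrC addrK.
by apply: ZspanD => //; apply: ZspanN; exact: Zspan_int.
Qed.

(** An open cube times the unit ball. The ball is an open subgroup, so only the real radius ever has
    to be halved. *)
Definition nbox (e : R) : set G :=
  [set p : G | (forall i, `|p.1 i ord0| < e) /\ cdist p.2 0 <= 1].

(** The unit cube is cut into cubes of side 1/K < e. The second coordinate already lies in the unit
    ball, so the representatives vary in the real part only. *)
Lemma Gam_cover (e : R) : 0 < e -> exists r : seq G, forall p : G,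
  exists g t, [/\ Gam g, t \in r & nbox e (p - g - t)].
Proof.
move=> e0; pose K := (Num.bound e^-1).+1.
have K0 : 0 < K%:R :> R by rewrite ltr0n.
have Ke : K%:R^-1 < e.
  rewrite -[ltRHS]invrK ltf_pV2 ?posrE ?invr_gt0//.
  apply: (@lt_trans _ _ (Num.bound e^-1)%:R); last by rewrite ltr_nat.
  by apply: archi_boundP; rewrite invr_ge0 ltW.
pose grid (f : {ffun 'I_n.+1 -> 'I_K}) : G := (\col_i ((f i)%:R / K%:R), 0).
exists [seq grid f | f : {ffun 'I_n.+1 -> 'I_K}] => p.
have [g Gg [p1 p2]] := Gam_cover_unit p.
pose u i : R := (p - g).1 i ord0.
have ut i : (Num.truncn (K%:R * u i))%:R <= K%:R * u i < (Num.truncn (K%:R * u i)).+1%:R.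
  by apply: truncn_itv; rewrite mulr_ge0//; have /andP[] := p1 i.
have hf i : (Num.truncn (K%:R * u i) < K)%N.
  have /andP[h0 h1] := p1 i; have /andP[h _] := ut i; rewrite -(ltr_nat R).
  by apply: le_lt_trans h _; rewrite gtr_pMr.
pose f := [ffun i => Ordinal (hf i)].
exists g, (grid f); split => //; first exact: codom_f.
split => [i|].
  have -> : (p - g - grid f).1 i ord0 = u i - (Num.truncn (K%:R * u i))%:R / K%:R.
    by rewrite -[(p - g - grid f).1]/((p - g).1 - (grid f).1) mxE [X in _ + X]mxE
      [X in _ - X]mxE ffunE.
  have /andP[h2 h3] := ut i; apply: le_lt_trans Ke; rewrite ger0_norm; last first.
    by rewrite subr_ge0 ler_pdivrMr// [u i * _]mulrC.
  rewrite lerBlDr -[X in _ <= X + _]mul1r -mulrDl ler_pdivlMr// [u i * _]mulrC.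
  by rewrite addrC natr1 ltW.
by rewrite -[(p - g - grid f).2]/((p - g).2 - 0) subr0.
Qed.

Lemma Gam_reps : (0 < Zindex A)%N -> exists r : 'I_(Zindex A) -> G,
  [/\ forall i, Gam (r i),
      forall g, Gam g -> exists i h, Gam h /\ g = r i + dilation h &
      forall i j h, Gam h -> r i = r j + dilation h -> i = j].
Proof.
move=> /Zindex_reps[r [Ar rc rd]].
have Lr i : r i \in laurent_pred B.
  by apply/asboolP/Zspan_Zlaurent; [exact: uA|exact: Ar].
exists (fun i => phi (Laurent (Lr i))); split.
- by move=> i; exists (Laurent (Lr i)) => //; exact: Ar.
- move=> _ [x /= Ax <-]; have [i [y [Ay xE]]] := rc _ Ax.
  have Ly : y \in laurent_pred B.
    by apply/asboolP/Zspan_Zlaurent => //; exact: uA.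
  exists i, (phi (Laurent Ly)); split; first by exists (Laurent Ly).
  by rewrite dil_phi -phiD; congr phi; apply: val_inj; rewrite [RHS]raddfD.
- move=> i j _ [y /= Ay <-]; rewrite dil_phi -phiD => /phi_inj /(congr1 val).
  by rewrite [RHS]raddfD; exact: rd.
Qed.

Lemma iter_conD k p q : iter k contraction (p + q) = iter k contraction p + iter k contraction q.
Proof. by elim: k => //= k ->; rewrite conD. Qed.

Lemma iter_dilD k p q : iter k dilation (p + q) = iter k dilation p + iter k dilation q.
Proof. by elim: k => //= k ->; rewrite dilD. Qed.

Lemma iter_con0 k : iter k contraction 0 = 0.
Proof. by apply: (addrI (iter k contraction 0)); rewrite -iter_conD !addr0. Qed.

Lemma iter_dil0 k : iter k dilation 0 = 0.
Proof. by apply: (addrI (iter k dilation 0)); rewrite -iter_dilD !addr0. Qed.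

Lemma iter_conN k p : iter k contraction (- p) = - iter k contraction p.
Proof. by apply/eqP; rewrite -addr_eq0 -iter_conD addNr iter_con0. Qed.

Lemma iter_dilN k p : iter k dilation (- p) = - iter k dilation p.
Proof. by apply/eqP; rewrite -addr_eq0 -iter_dilD addNr iter_dil0. Qed.

Lemma iter_dilK k : cancel (iter k dilation) (iter k contraction).
Proof. by elim: k => // k IH p; rewrite iterSr iterS dilK IH. Qed.

Lemma iter_conK k : cancel (iter k contraction) (iter k dilation).
Proof. by elim: k => // k IH p; rewrite iterSr iterS conK IH. Qed.

Lemma Gam_iter_dil k g : Gam g -> Gam (iter k dilation g).
Proof. by move=> Gg; elim: k => //= k; exact: GamM. Qed.

(** A^-k Gam meets finitely many cosets of Gam: for g = r_i + A h, A^-(k+1) g = A^-k h + A^-(k+1)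
    r_i. *)
Lemma Gam_index (k : nat) : (0 < Zindex A)%N -> exists r : seq G,
  forall g, Gam g -> exists h t, [/\ Gam h, t \in r & iter k contraction g = h + t].
Proof.
move=> /Gam_reps[r [_ rc _]]; elim: k => [|k [s sP]].
  by exists [:: 0] => g Gg; exists g, 0; split; rewrite ?inE ?addr0.
exists [seq t + iter k contraction (contraction (r i)) | i <- enum 'I_(Zindex A), t <- s] => g Gg.
have [i [h [Gh ->]]] := rc _ Gg; have [h' [t [Gh' ts hE]]] := sP _ Gh.
exists h', (t + iter k contraction (contraction (r i))); split => //.
  by apply/allpairsP; exists (i, t); split => //; rewrite mem_enum.
by rewrite iterSr conD dilK iter_conD hE addrC addrA.
Qed.

Lemma iter_con1 k p : (iter k contraction p).1 = map_mx ratr (B ^+ k) *m p.1.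
Proof.
elim: k => [|k IH]; first by rewrite expr0 map_mx1 mul1mx.
by rewrite iterS /= IH mulmxA -map_mxM exprS mulmxE.
Qed.

Lemma iter_dil1 k p : (iter k dilation p).1 = map_mx ratr (A ^+ k) *m p.1.
Proof.
elim: k => [|k IH]; first by rewrite expr0 map_mx1 mul1mx.
by rewrite iterS /= IH mulmxA -map_mxM exprS mulmxE.
Qed.

Lemma cdist_iter_con k p q :
  cdist (iter k contraction p).2 (iter k contraction q).2 = b ^- k * cdist p.2 q.2.
Proof.
elim: k => [|k IH]; first by rewrite expr0 invr1 mul1r.
by rewrite !iterS /= cdist_divY IH mulrA exprS invfM.
Qed.

Lemma cdist_iter_dil k p q :
  cdist (iter k dilation p).2 (iter k dilation q).2 = b ^+ k * cdist p.2 q.2.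
Proof.
elim: k => [|k IH]; first by rewrite expr0 mul1r.
by rewrite !iterS /= cdist_mulY IH mulrA exprS.
Qed.

Definition cbox (r s : R) : set G :=
  [set p : G | (forall i, `|p.1 i ord0| <= r) /\ cdist p.2 0 <= s].

Lemma con_shrink (r s e : R) : 0 < e -> exists k0, forall k p, (k0 <= k)%N ->
  cbox r s p -> (forall i, `|(iter k contraction p).1 i ord0| < e) /\
                cdist (iter k contraction p).2 0 < e.
Proof.
move=> e0; have [C [t [C0 t0 t1 BC]]] := expanding_inv_bound eA.
have t1' : `|ratr t : R| < 1 by rewrite -ratr_norm ger0_norm// -(rmorph1 (@ratr R)) ltr_rat.
have b1' : `|b^-1| < 1 by rewrite ger0_norm ?invf_lt1// invr_ge0 ltW.
have h1 : (fun k => n.+1%:R * (ratr C * ratr t ^+ k * r)) @ \oo --> (0 : R).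
  rewrite -(mulr0 n.+1%:R) -(mul0r r) -(mulr0 (ratr C)).
  apply: cvgM; first exact: cvg_cst.
  apply: cvgM; last exact: cvg_cst.
  apply: cvgM; first exact: cvg_cst.
  exact: cvg_expr.
have h2 : (fun k => b^-1 ^+ k * s) @ \oo --> (0 : R).
  rewrite -(mul0r s); apply: cvgM; last exact: cvg_cst.
  exact: cvg_expr.
have := filterI (cvgr0_norm_lt _ h1 _ e0) (cvgr0_norm_lt _ h2 _ e0).
move=> [k0 _ hk]; exists k0 => k p /hk[{h1}h1 {h2}h2] [p1 p2]; split.
  move=> i; rewrite iter_con1 mxE; apply: le_lt_trans (ler_norm_sum _ _ _) _.
  apply: le_lt_trans h1; apply: le_trans (ler_norm _).
  rewrite mulr_natl -[X in _ *+ X](card_ord n.+1) -sumr_const.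
  apply: ler_sum => j _; rewrite normrM mxE -ratr_norm.
  apply: ler_pM => //; first by rewrite ler0q.
  by rewrite -rmorphXn -rmorphM /= ler_rat.
have := cdist_iter_con k p 0; rewrite iter_con0 => ->.
apply: le_lt_trans h2; apply: le_trans (ler_norm _).
by rewrite -exprVn ler_wpM2l// exprn_ge0// invr_ge0 ltW.
Qed.

(** The limit defining [nu_completion] exists for two different reasons: at distance 0 the
    valuations tend to +oo, and elsewhere the ultrametric inequality makes them eventually
    constant. *)
Lemma ZB_integersE : @ZB_integers R n A eA b_ge2 = [set y : Y | cdist y 0 <= 1].
Proof.
apply/seteqP; suff h (y : Y) :
    (0 <= limn (fun i => nu R B (val (rseq y i))))%E <-> cdist y 0 <= 1.
  by split=> y /h.
pose x := rseq y; pose t i := nu R B (val (x i)).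
have tN i : t i != -oo%E by apply: nu_ninfty; [exact: uB|exact: b_ge2].
have dE i : d (x i) 0 = powb B (t i).
  by rewrite -[LHS]/(dB R (x i) 0) /dB [\val 0]raddf0 subr0.
have dc : (fun i => d (x i) 0) @ \oo --> cdist y 0.
  by have := @cdist_cpi _ _ d _ _ (@rseq_cauchy _ _ d y) (cauchy_seq_cst d 0); rewrite cpi_rseq.
have [c0|c0] := eqVneq (cdist y 0) 0.
  rewrite c0 ler01 (_ : limn t = +oo%E) ?leey//.
  apply: cvg_lim => //; apply/cvgeyPge => r; rewrite c0 in dc.
  have near_lt : \forall i \near \oo, d (x i) 0 < powb B r%:E.
    by apply: (cvgr_lt 0) => //; exact: powb_gt0.
  by apply: filterS near_lt => i; rewrite dE powb_lt//; exact: ltW.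
have {}c0 : 0 < cdist y 0 by rewrite lt_neqAle eq_sym c0 cdist_ge0.
have c20 : 0 < cdist y 0 / 2 by rewrite divr_gt0.
have c2c : cdist y 0 / 2 < cdist y 0 by rewrite gtr_pMr// invf_lt1// ltr1n.
have [N1 _ hN1] := cvgr_gt _ dc _ c2c.
have [N2 hN2] := @rseq_cauchy _ _ d y _ c20.
pose N := maxn N1 N2.
(* Beyond [N] two terms are closer to each other than either is to 0, so they have the same distance
   to 0. *)
have le_d i j : (N <= i)%N -> (N <= j)%N -> d (x i) 0 <= d (x j) 0.
  rewrite !geq_max => /andP[iN1 iN2] /andP[jN1 jN2]; apply: (@dB_ultra _ _ _ b_ge2 _ (x j)).
    by apply/ltW/(lt_trans (hN2 _ _ iN2 jN2)); exact: hN1.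
  exact: lexx.
have tE i : (N <= i)%N -> t i = t N.
  move=> Ni; apply: (powb_inj b_ge2) => //; rewrite -!dE.
  by apply/eqP; rewrite eq_le !le_d.
have -> : limn t = t N.
  by apply: lim_near_cst => //; exists N => // i /= /tE.
have -> : cdist y 0 = d (x N) 0.
  apply: (cvg_unique (@Rhausdorff R) dc); apply: cvg_near_cst.
  by exists N => // i Ni; change (d (x i) 0 = d (x N) 0); rewrite !dE tE.
by rewrite d_le1; apply: nu_ge0P => //; exact: uA.
Qed.

(** * Cells and their measure *)

Lemma open_le_cball (c : Y) (s : R) : 0 < s -> open [set y : Y | cdist y c <= s].
Proof.
move=> s0; rewrite openE => y /= ys; apply/nbhs_ballP; exists s => // z.
change (is_true (cdist y z < s) -> is_true (cdist z c <= s)); rewrite cdist_sym => zs.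
by apply: (cdistY_ultra (ltW zs)).
Qed.

(** The set t + A^-k [nbox e], written as a preimage. *)
Definition cell (e : R) (k : nat) (t : G) : set G :=
  [set p | nbox e (iter k dilation (p - t))].

Lemma cellE e k t : cell e k t =
  [set x | forall i, `|(map_mx ratr (A ^+ k) *m (x - t.1)) i ord0| < e] `*`
  [set y | cdist y t.2 <= b ^- k].
Proof.
have h p : (cdist (iter k dilation (p - t)).2 0 <= 1) = (cdist p.2 t.2 <= b ^- k).
  have := cdist_iter_dil k (p - t) 0; rewrite iter_dil0 => ->.
  rewrite -[(p - t).2]/(p.2 - t.2) cdist_sub -ler_pdivlMl ?exprn_gt0//.
  by rewrite mulr1.
by apply/seteqP; split=> p; rewrite /cell /nbox /= h iter_dil1.
Qed.

Lemma measurable_linear_box k (e : R) :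
  measurable [set x : 'cV[R]_n.+1 | forall i, `|(map_mx ratr (A ^+ k) *m x) i ord0| < e].
Proof.
pose f i (x : 'cV[R]_n.+1) : R := (map_mx ratr (A ^+ k) *m x) i ord0.
rewrite [X in measurable X](_ : _ = \bigcap_(i in [set: 'I_n.+1]) (f i @^-1` ball 0 e)).
  apply: fin_bigcap_measurable => // i _; rewrite -[X in measurable X]setTI.
  suff mf : measurable_fun setT (f i) by apply: mf => //; exact: measurable_ball.
  rewrite /f; under eq_fun do rewrite mxE.
  apply: measurable_sum => j; apply: measurable_funM => //.
  exact: measurable_col_coord.
apply/seteqP; split=> x /= h i; first by move=> _; rewrite /ball/= sub0r normrN; exact: h.
by have := h i I; rewrite /ball/= sub0r normrN.
Qed.

Lemma measurable_cell e k t : measurable (cell e k t).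
Proof.
rewrite cellE; apply: measurableX.
  have := measurable_col_shift (- t.1) measurableT (measurable_linear_box k e).
  by rewrite setTI.
by apply: sub_sigma_algebra; apply: open_le_cball; rewrite invr_gt0 exprn_gt0.
Qed.

Definition bbox (r : R) (y : Y) : set G :=
  [set p : G | (forall i, `|p.1 i ord0| <= r) /\ cdist p.2 y <= 1].

Lemma bboxE r y : bbox r y =
  [set x : 'cV[R]_n.+1 | forall i, `|x i ord0| <= r] `*` [set z | cdist z y <= 1].
Proof. by []. Qed.

Lemma measurable_bbox r y : measurable (bbox r y).
Proof.
rewrite bboxE; apply: measurableX; first exact: measurable_col_box.
by apply: sub_sigma_algebra; exact: open_le_cball.
Qed.

Section Measure.
Variable lam : {measure set 'cV[R]_n.+1 -> \bar R}.
Hypothesis lam_shift : forall (t : 'cV[R]_n.+1) (E : set 'cV[R]_n.+1),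
  measurable E -> lam ((fun x => x + t) @^-1` E) = lam E.
Hypothesis lam_box : forall r : R,
  (lam [set x | forall i, (`|x i ord0| <= r)%R] < +oo)%E.
Variable muB : {sigma_finite_measure set Y -> \bar R}.
Hypothesis muB_shift : forall (y : Y) (E : set Y), measurable E ->
  muB [set y + x | x in E] = muB E.
Hypothesis muB1 : muB [set y | cdist y 0 <= 1] = 1%E.
Let mu := (lam \x muB)%E.

Lemma muB_ball (c : Y) (s : R) : 0 < s ->
  muB [set y | cdist y c <= s] = muB [set y | cdist y 0 <= s].
Proof.
move=> s0; rewrite -[RHS](muB_shift c); last first.
  by apply: sub_sigma_algebra; exact: open_le_cball.
congr (muB _); apply/seteqP; split=> [y /= yc|_ /= [x xs <-]].
  by exists (y - c); [rewrite cdist_sub|rewrite addrC subrK].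
by rewrite -cdist_sub addrAC subrr add0r.
Qed.

(** Both factors of a cell are translates of sets depending only on [e] and [k]. *)
Lemma mu_cell e k t : mu (cell e k t) = mu (cell e k 0).
Proof.
have bk : 0 < b ^- k by rewrite invr_gt0 exprn_gt0.
have mX (s : G) : measurable [set x : 'cV[R]_n.+1 |
    forall i, `|(map_mx ratr (A ^+ k) *m (x - s.1)) i ord0| < e].
  have := measurable_col_shift (- s.1) measurableT (measurable_linear_box k e).
  by rewrite setTI.
have mY (s : G) : measurable [set y : Y | cdist y s.2 <= b ^- k].
  by apply: sub_sigma_algebra; exact: open_le_cball.
have XE (s : G) : [set x : 'cV[R]_n.+1 |
    forall i, `|(map_mx ratr (A ^+ k) *m (x - s.1)) i ord0| < e] =
    (fun x => x + - s.1) @^-1`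
      [set x | forall i, `|(map_mx ratr (A ^+ k) *m x) i ord0| < e] by [].
have muE (s : G) : mu (cell e k s) =
    (lam [set x | forall i, (`|(map_mx ratr (A ^+ k) *m x) i ord0| < e)%R] *
     muB [set y | (cdist y 0 <= b ^- k)%R])%E.
  rewrite cellE /mu product_measure1E; [|exact: mX|exact: mY].
  by rewrite muB_ball// XE lam_shift//; exact: measurable_linear_box.
by rewrite !muE.
Qed.

Lemma mu_bbox r y : (mu (bbox r y) < +oo)%E.
Proof.
rewrite bboxE /mu product_measure1E; last 2 first.
- exact: measurable_col_box.
- by apply: sub_sigma_algebra; exact: open_le_cball.
by rewrite muB_ball// muB1 mule1 lam_box.
Qed.

End Measure.

(** * Invariant open sets have negligible complement *)

Section NullComplement.
Variable lam : {measure set 'cV[R]_n.+1 -> \bar R}.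
Hypothesis lam_shift : forall (t : 'cV[R]_n.+1) (E : set 'cV[R]_n.+1),
  measurable E -> lam ((fun x => x + t) @^-1` E) = lam E.
Hypothesis lam_box : forall r : R,
  (lam [set x | forall i, (`|x i ord0| <= r)%R] < +oo)%E.
Variable muB : {sigma_finite_measure set Y -> \bar R}.
Hypothesis muB_shift : forall (y : Y) (E : set Y), measurable E ->
  muB [set y + x | x in E] = muB E.
Hypothesis muB1 : muB [set y | cdist y 0 <= 1] = 1%E.
Let mu : {measure set G -> \bar R} := (lam \x muB)%E.

Lemma seq_cbox (s : seq G) : exists r, forall t, t \in s -> cbox r r t.
Proof.
elim: s => [|t s [r hr]]; first by exists 0 => t; rewrite in_nil.
pose r' := \sum_i `|t.1 i ord0| + cdist t.2 0.
have sum0 : 0 <= \sum_i `|t.1 i ord0| by apply: sumr_ge0.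
exists (Num.max r r') => u; rewrite inE => /orP[/eqP ->|/hr[h1 h2]].
  split=> [i|]; rewrite le_max; apply/orP; right; last by rewrite lerDr.
  rewrite /r' (bigD1 i)//= -addrA lerDl addr_ge0// ?cdist_ge0//.
  exact: sumr_ge0.
by split=> [i|]; rewrite le_max ?h1 ?h2.
Qed.

Lemma cboxD r s r' s' p q : cbox r s p -> cbox r' s' q -> cbox (r + r') (s + s') (p + q).
Proof.
move=> [p1 p2] [q1 q2]; split=> [i|].
  rewrite -[(p + q).1]/(p.1 + q.1) mxE; apply: le_trans (ler_normD _ _) _.
  exact: lerD.
rewrite -[(p + q).2]/(p.2 + q.2).
apply: le_trans (cdist_triangle q.2 _ _) _; rewrite -[X in cdist _ X + _]add0r cdistDr.
exact: lerD.
Qed.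

Lemma cboxN r s p : cbox r s p -> cbox r s (- p).
Proof.
move=> [p1 p2]; split=> [i|]; last by rewrite -[(- p).2]/(- p.2) cdistN.
by rewrite -[(- p).1]/(- p.1) mxE normrN.
Qed.

Lemma cboxB r s r' s' p q : cbox r s p -> cbox r' s' q -> cbox (r + r') (s + s') (p - q).
Proof. by move=> hp hq; exact: cboxD hp (cboxN hq). Qed.

Lemma nbox_sub_eq e : (forall g, Gam g ->
    (forall i, `|g.1 i ord0| < e) -> cdist g.2 0 <= 1 -> g = 0) ->
  forall p q, nbox (e / 2) p -> nbox (e / 2) q -> Gam (p - q) -> p = q.
Proof.
move=> he p q [p1 p2] [q1 q2] /he h; apply/eqP; rewrite -subr_eq0; apply/eqP/h.
  move=> i; rewrite -[(p - q).1]/(p.1 - q.1) mxE [X in _ + X]mxE.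
  by apply: le_lt_trans (ler_normB _ _) _; rewrite [ltRHS]splitr ltrD.
rewrite -[(p - q).2]/(p.2 - q.2) cdist_sub.
by apply: (cdistY_ultra p2); rewrite cdist_sym.
Qed.

(** [c k g] is A^-k (q0 + g + A^-k0 [nbox e]), a piece of U, and [Q k g] adds finitely many
    translates of it so that the [Q k g] cover the space. Their number [size rs] is independent of
    k, which gives the fixed proportion. *)
Lemma null_complement_bbox (U : set G) (r : R) (y : Y) : (0 < Zindex A)%N ->
  open U -> U !=set0 ->
  (forall q g, U q -> Gam g -> U (q - g)) -> (forall q, U q -> U (contraction q)) ->
  mu (~` U `&` bbox r y) = 0.
Proof.
move=> a0 oU [q0 Uq0] UGam Ucon.
have [e1 e10 disc] := @Gam_discrete.
pose e := e1 / 2; have e0 : 0 < e by rewrite divr_gt0.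
have [d0 d00 Ud0] := (open_boxP U).1 oU _ Uq0.
(* After [k0] contractions [nbox e] fits into the box around [q0] contained in U. *)
have [k0 hk0] := @con_shrink e 1 d0 d00.
have nbox_con p : nbox e p -> cbox d0 d0 (iter k0 contraction p) /\ U (q0 + iter k0 contraction p).
  move=> [p1 p2]; have [h1 h2] : (forall i, `|(iter k0 contraction p).1 i ord0| < d0) /\
      cdist (iter k0 contraction p).2 0 < d0.
    by apply: hk0 => //; split=> // i; exact: ltW.
  split; first by split=> [i|]; exact: ltW.
  apply: Ud0 => [i|].
    by rewrite -[(q0 + _).1]/(q0.1 + (iter k0 contraction p).1) mxE addrAC subrr add0r.
  rewrite -[(q0 + _).2]/(q0.2 + (iter k0 contraction p).2) -cdist_sub.
  by rewrite addrAC subrr add0r.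
have [r0 hr0] := @Gam_cover e e0.
have [r1 hr1] := @Gam_index k0 a0.
pose rs : seq G := 0 :: [seq iter k0 contraction t + t' | t <- r0, t' <- r1].
pose c k g := cell e (k + k0) (iter k contraction (q0 + g)).
pose Q k g := \bigcup_(t in [set` rs]) cell e (k + k0) (iter k contraction (q0 + g + t)).
have cP k g p : c k g p -> exists2 u, nbox e u &
    p = iter k contraction (q0 + g + iter k0 contraction u).
  move=> cp; exists (iter (k + k0) dilation (p - iter k contraction (q0 + g))) => //.
  rewrite iter_conD -iterD iter_dilK addrC subrK //.
have QP k g p : Q k g p -> exists t u, [/\ t \in rs, nbox e u &
    p = iter k contraction (q0 + g + t + iter k0 contraction u)].
  move=> [t /= trs Qp]; exists t, (iter (k + k0) dilation (p - iter k contraction (q0 + g + t))).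
  by split => //; rewrite iter_conD -iterD iter_dilK addrC subrK.
have Qcover k p : exists2 g, Gam g & Q k g p.
  (* At scale k + k0 the point is g + t up to [nbox e]; with A^-k0 g = h + t', the index of its cell
     is h and the offset A^-k0 t + t'. *)
  have [g [t [Gg tr0 u]]] := hr0 (iter (k + k0) dilation p - iter k0 dilation q0).
  have [h [t' [Gh tr1 hE]]] := hr1 _ Gg.
  exists h => //; exists (iter k0 contraction t + t').
    by rewrite /= inE; apply/orP; right; apply/allpairsP; exists (t, t').
  rewrite /cell /cell /=; congr (nbox e _): u.
  have gE : iter k0 dilation h + iter k0 dilation t' = g by rewrite -iter_dilD -hE iter_conK.
  have cE : iter (k + k0) dilation (iter k contraction (q0 + h + (iter k0 contraction t + t'))) =
      iter k0 dilation q0 + iter k0 dilation h + (t + iter k0 dilation t').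
    by rewrite addnC iterD iter_conK !iter_dilD iter_conK.
  rewrite iter_dilD iter_dilN cE -gE !opprD !addrA.
  by rewrite [LHS]addrAC.
pose E := ~` U `&` bbox r y.
have mE : measurable E.
  apply: measurableI; last exact: measurable_bbox.
  by apply: measurableC; apply: measurable_open_prod => //; exact: countable_laurent.
have mc k g : measurable (c k g) by exact: measurable_cell.
have mQ k g : measurable (Q k g).
  by rewrite /Q bigcup_seq; apply: bigsetU_measurable => t _; exact: measurable_cell.
have Qc k g : (mu (Q k g) <= (size rs)%:R%:E * mu (c k g))%E.
  have mucell k' t : mu (cell e k' t) = mu (cell e k' 0).
    exact: (mu_cell lam_shift muB_shift).
  rewrite /Q bigcup_seq /c mucell.
  pose F t := cell e (k + k0) (iter k contraction (q0 + g + t)).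
  elim: rs {Q QP Qcover mQ} => [|t s IH]; first by rewrite big_nil measure0 mul0e.
  have -> : (size (t :: s))%:R%:E = ((size s)%:R%:E + 1)%E :> \bar R.
    by rewrite -EFinD natr1.
  rewrite big_cons ge0_muleDl ?lee_fin// mul1e.
  apply: (@le_trans _ _ (mu (F t) + mu (\big[setU/set0]_(j <- s) F j))%E).
    apply: measureU2; first exact: measurable_cell.
    by apply: bigsetU_measurable => j _; exact: measurable_cell.
  rewrite addeC; apply: leeD; first exact: IH.
  by rewrite /F mucell; exact: lexx.
(* A common point gives A^-k0 (u - u') = h - g. Then u - u' lies in Gam, and [e], half the
   discreteness radius, forces u = u'. *)
have cdisj k g h : Gam g -> Gam h -> c k g `&` c k h !=set0 -> g = h.
  move=> Gg Gh [p [cgp chp]]; have [u oO pE] := cP _ _ _ cgp.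
  have [u' oO' pE'] := cP _ _ _ chp.
  have := can_inj (iter_conK k) (etrans (esym pE) pE').
  rewrite -!addrA => /addrI E1.
  have E2 : iter k0 contraction (u - u') = h - g.
    rewrite iter_conD iter_conN; apply/eqP.
    by rewrite subr_eq addrAC -E1 addrAC subrr add0r.
  have oo : u = u'.
    apply: (nbox_sub_eq disc) => //.
    rewrite -(iter_conK k0 (u - u')) E2; apply: Gam_iter_dil.
    exact/GamD/GamN.
  by move: E1; rewrite oo => /addIr.
have cU k g : Gam g -> c k g `<=` U.
  move=> Gg p /cP[u /nbox_con[_ Uo] ->]; elim: k => [|k IH]; last first.
    by rewrite iterS; exact: Ucon.
  rewrite addrAC -[g]opprK; apply: UGam => //; exact: GamN.
have [rho hrho] := seq_cbox rs.
(* A point of a cell, scaled up by A^k, differs from q0 + g by an offset of size at most [rho] and a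
   contracted box point of size at most [d0]; [w] doubles this for a difference. *)
pose w := rho + d0 + (rho + d0).
have Qdiff k g p q : Q k g p -> Q k g q -> exists2 v, cbox w w v & p - q = iter k contraction v.
  move=> /QP[t [u [trs oO ->]]] /QP[t' [u' [trs' oO' ->]]].
  exists ((t + iter k0 contraction u) - (t' + iter k0 contraction u')).
    apply: cboxB; apply: cboxD.
    - exact: hrho.
    - exact: (nbox_con _ oO).1.
    - exact: hrho.
    - exact: (nbox_con _ oO').1.
  rewrite -iter_conN -iter_conD; congr (iter k contraction _).
  have cancel3 (Z : zmodType) (x x1 x2 x3 x4 : Z) :
      x + x1 + x2 - (x + x3 + x4) = x1 + x2 - (x3 + x4).
    by rewrite -(addrA x x1) -(addrA x x3) [x + (x1 + x2)]addrC addrKA.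
  exact: cancel3.
have Qnear del : 0 < del -> exists j0, forall j g p q, (j0 <= j)%N ->
    Q j g p -> Q j g q -> (forall i, `|p.1 i ord0 - q.1 i ord0| < del) /\ cdist p.2 q.2 < del.
  move=> del0; have [j0 hj0] := @con_shrink w w del del0.
  exists j0 => j g p q jj0 Qp Qq; have [v hv pq] := Qdiff _ _ _ _ Qp Qq.
  have [h1 h2] := hj0 _ _ jj0 hv; rewrite -pq in h1 h2; split=> [i|].
    by have := h1 i; rewrite -[(p - q).1]/(p.1 - q.1) mxE [X in _ + X]mxE.
  by rewrite -cdist_sub.
(* [null_of_cells] takes cells indexed by integers, so the countable group Gam is numbered by [f],
   with partial inverse [dec]. *)
have [f finj] : exists f : G -> nat, {in Gam &, injective f}.
  apply/countable_injP; apply: (@sub_countable _ _ _ [set: laurent B]); last exact: countable_laurent.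
  by apply: card_le_trans (card_image_le _ _) _; exact: card_leT.
pose D := [set f g | g in Gam].
have hdec i : exists g, D i -> Gam g /\ f g = i.
  by have [[g Gg <-]|nD] := pselect (D i); [exists g|exists 0].
have [dec decP] := boolp.choice hdec.
have decf g : Gam g -> dec (f g) = g.
  move=> Gg; have [Gd fd] : Gam (dec (f g)) /\ f (dec (f g)) = f g by apply: decP; exists g.
  by apply: finj => //; rewrite inE.
apply: (@null_of_cells _ _ _ mu E (size rs) D (fun k i => c k (dec i)) (fun k i => Q k (dec i))) => //.
- move=> k p _; have [g Gg Qp] := Qcover k p; exists (f g); first by exists g.
  by rewrite decf.
- move=> k i j Di Dj /cdisj ij.
  have [Gi fi] := decP _ Di; have [Gj fj] := decP _ Dj.
  by rewrite -fi -fj ij.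
- move=> k i /decP[Gi _]; apply/seteqP; split=> // p [/(cU _ _ Gi) Up [nU _]].
  exact: nU.
- move=> k i p cp; exists 0; first by rewrite /= inE eqxx.
  by rewrite addr0.
- move=> p Sp; apply: contrapT => nEp.
  (* E is closed, so a point outside it has a neighbourhood missing E; small cells through that
     point cannot meet E. *)
  have [del del0 hdel] : exists2 del : R, 0 < del & forall q : G,
      (forall i, `|p.1 i ord0 - q.1 i ord0| < del) -> cdist p.2 q.2 < del -> ~ E q.
    have [Up|nUp] := pselect (U p).
      have [del del0 h] := (open_boxP U).1 oU _ Up.
      exists del => // q q1 q2 [nUq _]; apply/nUq/h => [i|]; first by rewrite distrC.
      by rewrite cdist_sym.
    have [p1|] := pselect (forall i, `|p.1 i ord0| <= r).
      have p2 : ~ (cdist p.2 y <= 1) by move=> p2; apply: nEp.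
      exists 1 => // q _ q2 [_ [_ q3]]; apply: p2.
      exact: (cdistY_ultra (ltW q2)).
    move=> /existsNP[i /negP]; rewrite -ltNge => pi.
    exists (`|p.1 i ord0| - r); first by rewrite subr_gt0.
    move=> q /(_ i) q1 _ [_ [/(_ i) q2 _]]; move: q1; apply/negP; rewrite -leNgt.
    rewrite lerBlDr; apply: le_trans (lerD (lexx _) q2).
    by rewrite -{1}(subrK (q.1 i ord0) (p.1 i ord0)); exact: ler_normD.
  have [j0 hj0] := Qnear _ del0.
  have [j /= jj0 [i [Di [q [Qq Eq]]] Qp]] := Sp j0 I.
  by have [h1 h2] := hj0 _ _ _ _ jj0 Qp Qq; exact: (hdel q).
(* Cells of scale at least [j0] that meet E stay within distance 1 of it, hence in a larger bounded
   box. *)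
- have [j0 hj0] := Qnear 1 ltr01; exists j0.
  apply: (@le_lt_trans _ _ (mu (bbox (1 + r) y))); last exact: mu_bbox.
  apply: le_measure; rewrite ?inE; last 2 first.
  + exact: measurable_bbox.
  + move=> p [j /= jj0 [i [Di [q [Qq [_ [q1 q2]]]]] Qp]].
    have [h1 h2] := hj0 _ _ _ _ jj0 Qp Qq; split=> [l|]; last first.
      exact: (cdistY_ultra (ltW h2)).
    rewrite -(subrK (q.1 l ord0) (p.1 l ord0)); apply: le_trans (ler_normD _ _) _.
    by apply: lerD => //; exact: ltW.
  by apply: bigcup_measurable => j _; apply: bigcup_measurable => i _; exact: mQ.
Qed.

(** The space is a countable union of bounded boxes, the unit balls around the countable dense image
    of Z^n(B) covering the second factor. *)
Lemma null_complement (U : set G) : (0 < Zindex A)%N ->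
  open U -> U !=set0 ->
  (forall q g, U q -> Gam g -> U (q - g)) -> (forall q, U q -> U (contraction q)) ->
  mu.-negligible (~` U).
Proof.
move=> a0 oU U0 UGam Ucon.
have mU : measurable (~` U).
  by apply: measurableC; apply: measurable_open_prod => //; exact: countable_laurent.
have [e eP] : exists e : nat -> laurent B, forall x, exists i, e i = x.
  have /countable_injP[f finj] := countable_laurent.
  have he i : exists x, forall x', f x' = i -> x = x'.
    have [[x fx]|nx] := pselect (exists x, f x = i); last first.
      by exists 0 => x fx; exfalso; apply: nx; exists x.
    by exists x => x' fx'; apply: finj; rewrite ?inE// fx fx'.
  have [e eP] := boolp.choice he.
  by exists e => x; exists (f x); exact: eP.
apply: (@negligibleS _ _ _ mu
    (\bigcup_i \bigcup_m (~` U `&` bbox m%:R (canonical_map d (e i))))).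
  move=> p nUp; have [a pa] := @canonical_dense _ _ d p.2 1 ltr01.
  have [i ei] := eP a; have [r hr] := seq_cbox [:: p].
  have [hp _] := hr p (mem_head _ _).
  exists i => //; exists (Num.bound r) => //; split=> //; split=> [j|]; last by rewrite ei.
  apply: le_trans (hp j) _; apply/ltW/archi_boundP.
  exact: le_trans (normr_ge0 _) (hp j).
apply: negligible_bigcup => i; apply: negligible_bigcup => m.
apply/negligibleP; last exact: null_complement_bbox.
by apply: measurableI => //; exact: measurable_bbox.
Qed.

End NullComplement.

(** * Local finiteness and semicontinuity of the multiplicity *)

Section Multiplicity.
Variable F : set G.
Hypothesis cF : compact F.
Notation incidence := (incidence Gam F).
Notation multiplicity := (multiplicity Gam F).

Lemma closed_tile : closed F.
Proof.
apply: compact_closed cF => p q pq; have h1 : p.1 = q.1.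
  apply: (@norm_hausdorff R 'cV[R]_n.+1) => U V Up Vq.
  have [w [Uw Vw]] := pq (U `*` setT) (V `*` setT)
    (ex_intro2 _ _ (U, setT) (conj Up filterT) (@subset_refl _ _))
    (ex_intro2 _ _ (V, setT) (conj Vq filterT) (@subset_refl _ _)).
  by exists w.1; split; [exact: Uw.1|exact: Vw.1].
have h2 : p.2 = q.2.
  apply: (@metric_hausdorff R Y) => U V Up Vq.
  have [w [Uw Vw]] := pq (setT `*` U) (setT `*` V)
    (ex_intro2 _ _ (setT, U) (conj filterT Up) (@subset_refl _ _))
    (ex_intro2 _ _ (setT, V) (conj filterT Vq) (@subset_refl _ _)).
  by exists w.2; split; [exact: Uw.2|exact: Vw.2].
by case: p q h1 h2 {pq} => p1 p2 [q1 q2] /= -> ->.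
Qed.

Lemma coordB (p q : G) i : (p - q).1 i ord0 = p.1 i ord0 - q.1 i ord0.
Proof. by rewrite -[(p - q).1]/(p.1 - q.1) mxE [X in _ + X]mxE. Qed.

Lemma open_shift (W : set G) (g : G) : open W -> open [set p | W (p - g)].
Proof.
move=> /open_boxP oW; apply/open_boxP => p /oW[e e0 h]; exists e => // q q1 q2.
apply: h => [i|].
  by rewrite !coordB opprB addrA subrK; exact: q1.
by rewrite -[(q - g).2]/(q.2 + - g.2) -[(p - g).2]/(p.2 + - g.2) cdistDr.
Qed.

Lemma open_nbox (e : R) : open (nbox e).
Proof.
apply/open_boxP => p [p1 p2].
pose m := \big[Num.min/1]_i (e - `|p.1 i ord0|).
have m0 : 0 < m by rewrite lt_bigmin// => i _; rewrite subr_gt0.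
exists m; [exact: m0|move=> q q1 q2; split=> [i|]].
  rewrite -(subrK (p.1 i ord0) (q.1 i ord0)); apply: le_lt_trans (ler_normD _ _) _.
  rewrite -ltrBrDr; apply: lt_le_trans (q1 i) _.
  exact: bigmin_le_cond.
have qp : cdist q.2 p.2 <= 1 by apply/ltW/(lt_le_trans q2); exact: bigmin_le_id.
exact: (cdistY_ultra qp p2).
Qed.

Lemma nboxB (e : R) p q : nbox (e / 2) p -> nbox (e / 2) q -> nbox e (p - q).
Proof.
move=> [p1 p2] [q1 q2]; split=> [i|]; last first.
  rewrite -[(p - q).2]/(p.2 - q.2) cdist_sub.
  by apply: (cdistY_ultra p2); rewrite cdist_sym.
rewrite coordB; apply: le_lt_trans (ler_normB _ _) _.
by rewrite [ltRHS]splitr ltrD.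
Qed.

(** Compactness covers F by finitely many small boxes, and by discreteness each box accounts for at
    most one g. *)
Lemma locally_finite_tile : exists2 e : R, 0 < e & forall p,
  finite_set [set g | Gam g /\ exists2 u, nbox e u & F (p + u - g)].
Proof.
have [e1 e10 disc] := @Gam_discrete.
(* g - h will be a difference of two differences of small points, so the discreteness radius is
   halved twice. *)
pose e := e1 / 2 / 2; have e0 : 0 < e by rewrite !divr_gt0.
exists e => // p.
pose T : ptopologicalType := HB.pack G (isPointed.Build G (0 : G)).
have : @cover_compact T F by rewrite -compact_cover; exact: cF.
move=> /(_ _ F (fun x => [set q | nbox e (q - x)])).
case=> [x _|x Fx|X XF Xcov].
- by apply: open_shift; exact: open_nbox.
- exists x => //=; rewrite subrr; split=> [i|]; last by rewrite cdistxx.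
  by rewrite mxE normr0.
pose S x := [set g | Gam g /\ exists2 u, nbox e u & nbox e (p + u - g - x)].
apply: (@sub_finite_set _ _ (\bigcup_(x in [set` X]) S x)).
  move=> g [Gg [u eu Fu]]; have [x Xx nx] := Xcov _ Fu.
  by exists x => //; split => //; exists u.
apply: bigcup_finite => // x _.
have S1 g h : S x g -> S x h -> g = h.
  move=> [Gg [u hu hv]] [Gh [u' hu' hv']].
  have E : (u - u') - ((p + u - g - x) - (p + u' - h - x)) = g - h.
    have hz (Z : zmodType) (a1 a2 a3 a4 a5 a6 : Z) :
        (a1 - a2) - ((a3 + a1 - a4 - a5) - (a3 + a2 - a6 - a5)) = a4 - a6.
      rewrite [X in _ - X](_ : _ = a1 - a2 - (a4 - a6)) ?subKr//.
      rewrite opprB [a3 + a1 - a4 - a5 + _]addrA subrK -!(addrA a3) !opprD opprK.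
      by rewrite addrCA addNKr addrACA.
    exact: hz.
  have := nbox_sub_eq disc (nboxB hu hu') (nboxB hv hv'); rewrite E => uv.
  by apply/eqP; rewrite -subr_eq0 -E uv ?subrr//; exact/GamD/GamN.
have [[g Sg]|nS] := pselect (exists g, S x g).
  by apply: (@sub_finite_set _ _ [set g]) => // h Sh; exact: S1.
by rewrite (_ : S x = set0)//; apply/seteqP; split=> // g Sg; apply: nS; exists g.
Qed.

Lemma finite_incidence p : finite_set (incidence p).
Proof.
have [e e0 /(_ p)] := locally_finite_tile; apply: sub_finite_set => g [Gg Fg].
split=> //; exists 0; last by rewrite addr0.
by split=> [i|]; rewrite ?cdistxx// mxE normr0.
Qed.

(** Near p only finitely many g can be incident, and since F is closed those not incident to p stay
    so nearby: incidences can be lost but not gained. *)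
Lemma open_multiplicity_le m : open [set p | (multiplicity p <= m)%N].
Proof.
rewrite openE => p /= pm; have [e e0 /(_ p) finS] := locally_finite_tile.
pose S := fset_set [set g | Gam g /\ exists2 u, nbox e u & F (p + u - g)].
have hS g : Gam g -> (exists2 u, nbox e u & F (p + u - g)) -> g \in S.
  by move=> Gg Hu; rewrite in_fset_set// inE.
pose W g := if pselect (F (p - g)) then setT else [set q | ~ F (q - g)].
have Wp : nbhs p (\bigcap_(g in [set` S]) W g).
  apply: filter_bigI => g _; rewrite /W; case: pselect => nF /=; first exact: filterT.
  apply: open_nbhs_nbhs; split => //.
  have := @open_shift (~` F) g; apply; exact/closed_openC/closed_tile.
have Vp : nbhs p [set q | nbox e (q - p)].
  apply: open_nbhs_nbhs; split; first by apply: open_shift; exact: open_nbox.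
  by rewrite /= subrr; split=> [i|]; rewrite ?cdistxx// mxE normr0.
apply: filterS (filterI Wp Vp) => q [Wq Vq] /=; apply: leq_trans pm.
apply: fsubset_leq_card; apply/fsubsetP => g /(in_incidence finite_incidence)[Gg Fq].
apply/(in_incidence finite_incidence); split => //; apply: contrapT => nF.
have gS : g \in S by apply: hS => //; exists (q - p) => //; rewrite [p + _]addrC subrK.
have := Wq g gS; rewrite /W; case: pselect => Fpg /=; first by move: (nF Fpg).
exact.
Qed.

(** A nonzero period t would put all f + k t into F, giving the point f infinitely many incidences
    -k t. *)
Lemma translate_inj s s' : F !=set0 -> Gam s -> Gam s' ->
  [set p + s | p in F] = [set p + s' | p in F] -> s = s'.
Proof.
move=> [f Ff] Gs Gs' ss'.
pose t := s - s'; have Gt : Gam t by exact/GamD/GamN.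
have Ft p : F p -> F (p + t).
  move=> Fp; have : [set p + s' | p in F] (p + s) by rewrite -ss'; exists p.
  by move=> [q Fq E]; rewrite /t addrA -E addrK.
have Ftk k : F (f + t *+ k).
  by elim: k => [|k IH]; rewrite ?addr0// mulrSr addrA; exact: Ft.
have Gtk k : Gam (- (t *+ k)).
  apply: GamN; elim: k => [|k IH]; first exact: Gam0.
  by rewrite mulrSr; exact: GamD.
apply/eqP; rewrite -subr_eq0 -/t; apply/negPn/negP => t0.
have t10 : t.1 != 0.
  move: Gt t0 => [x _ <-]; apply: contraNneq => x0; rewrite -phi0; apply/eqP.
  congr phi; apply: val_inj; rewrite raddf0; apply: (@map_mx_inj _ _ (@ratr R)).
  by rewrite map_mx0.
have t1k k : (t *+ k).1 = k%:R *: t.1.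
  by rewrite scaler_nat; elim: k => // k IH; rewrite !mulrS -IH.
have inj_tk : injective (fun k => - (t *+ k)).
  move=> k l /oppr_inj/(congr1 fst); rewrite !t1k => /eqP.
  by rewrite -subr_eq0 -scalerBl scaler_eq0 (negPf t10) orbF subr_eq0 eqr_nat => /eqP.
pose X := fset_set (incidence f).
have := @uniq_leq_size _ [seq - (t *+ k) | k <- iota 0 (size X).+1] X.
rewrite map_inj_uniq// iota_uniq size_map size_iota ltnn => /(_ isT) h; suff : false by []; apply: h.
move=> _ /mapP[k _ ->]; rewrite in_fset_set; last exact: finite_incidence.
by rewrite inE; split => //; rewrite opprK.
Qed.

End Multiplicity.

(** * From minimal multiplicity to the multiple tiling *)

Section Tiling.
Variables (F : set G) (D : {fset 'cV[rat]_n.+1}).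
Hypothesis cF : compact F.
Hypothesis F0 : F !=set0.
Hypothesis hD : digit_system A D.
Hypothesis hF : dilation @` F = \bigcup_(x in [set x | val x \in D]) [set p + phi x | p in F].
Notation multiplicity := (multiplicity Gam F).

Lemma index_gt0 : (0 < Zindex A)%N.
Proof.
have [_ _ <-] := hD; have [f Ff] := F0.
have : (dilation @` F) (dilation f) by exists f.
rewrite hF => -[x /= xD _]; rewrite lt0n; apply/eqP => /cardfs0_eq D0.
by move: xD; rewrite D0 in_fset0.
Qed.

Lemma multiplicity_con (m : nat) (q : G) : (forall p, (m <= multiplicity p)%N) ->
  (multiplicity q <= m)%N -> (multiplicity (contraction q) <= m)%N.
Proof.
move=> hm qm; have [_ DA cD] := hD.
have [r [Gr rc rd]] := @Gam_reps index_gt0.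
(* Digits lie in Z^n[A], hence in Z^n(B), so the default 0 of [insubd] is never taken. *)
pose D' : {fset G} := [fset phi (insubd 0 x) | x in D]%fset.
have hD' x : x \in D -> exists2 y : laurent B, val y = x & y = insubd 0 x.
  move=> xD; exists (insubd 0 x) => //; rewrite insubdK//.
  by apply/asboolP/Zspan_Zlaurent; [exact: uA|exact: DA].
(* Stability under [contraction] is the case g = 0 of the descent. *)
rewrite -[contraction q]/(contraction (q)) -(subr0 q).
apply: (@multiplicity_descent _ Gam dilation contraction F D' _ r) => //.
- exact: GamD.
- exact: GamN.
- exact: dilD.
- exact: conD.
- exact: conK.
- exact: dilK.
- exact: GamM.
- move=> _ /imfsetP[x /= xD ->]; have [y yx <-] := hD' _ xD.
  by exists y => //; rewrite /= yx; exact: DA.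
- by rewrite -cD; exact: leq_imfset_card.
- move=> f Ff; have : (dilation @` F) (dilation f) by exists f.
  rewrite hF => -[x /= xD [f' Ff' <-]]; exists (phi x), f'; split => //.
  by apply/imfsetP; exists (val x) => //=; rewrite valKd.
- exact: finite_incidence.
- exact: Gam0.
Qed.

Lemma multiple_tiling_of_null_complement (mu : {measure set G -> \bar R}) :
  (forall U : set G, open U -> U !=set0 ->
    (forall q g, U q -> Gam g -> U (q - g)) -> (forall q, U q -> U (contraction q)) ->
    mu.-negligible (~` U)) ->
  (0 < mu F)%E ->
  exists2 k : nat, (1 <= k)%N & {ae mu, forall p : G,
    ([set X | X p /\ exists2 s, Gam s & X = [set q + s | q in F]] #= `I_k)%card}.
Proof.
move=> hnull muF.
have finI := finite_incidence cF.
have [m hm [p0 p0m]] : exists2 m, (forall p, (m <= multiplicity p)%N) &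
    exists p, multiplicity p = m.
  have hex : exists k, `[< exists p, multiplicity p = k >].
    by exists (multiplicity 0); apply/asboolP; exists 0.
  case: (ex_minnP hex) => m /asboolP[p pm] hmin; exists m; last by exists p.
  by move=> q; apply: hmin; apply/asboolP; exists q.
pose U := [set p | (multiplicity p <= m)%N].
have nU : mu.-negligible (~` U).
  apply: hnull.
  - exact: open_multiplicity_le.
  - by exists p0; rewrite /U /= p0m.
  - move=> q g /= qm Gg; rewrite /U /= multiplicity_shift//; [exact: GamD|exact: GamN].
  - by move=> q /= qm; exact: multiplicity_con.
exists m.
  (* A point of F has the incidence g = 0, so m = 0 would place F inside the negligible complement
     of U. *)
  rewrite lt0n; apply/eqP => m0; move: muF.
  rewrite (measure_negligible (mu := mu) (A := F)) ?ltxx//.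
    rewrite -[F]setCK; apply: measurableC; apply: measurable_open_prod.
      exact: countable_laurent.
    by apply: closed_openC; exact: (closed_tile cF).
  apply: negligibleS nU => p Fp; rewrite /U m0 /= leqn0 cardfs_eq0 => /eqP J0.
  have : 0 \in fset_set (incidence Gam F p).
    by apply/(in_incidence finI); split; [exact: Gam0|rewrite subr0].
  by rewrite J0 in_fset0.
(* On U the multiplicity is exactly m, and [translate_inj] turns the count of g into a count of
   distinct sets. *)
apply: negligibleS nU => p; apply: contra_not => /= Up.
have Cm : multiplicity p = m by apply/eqP; rewrite eqn_leq Up hm.
have /finite_setP[k Jk] := finI p.
have km : k = m by rewrite -Cm /multiplicity (card_fset_set Jk).
rewrite -km.
have -> : [set X | X p /\ exists2 s, Gam s & X = [set q + s | q in F]] =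
    (fun s => [set q + s | q in F]) @` incidence Gam F p.
  apply/seteqP; split=> [X [Xp [s Gs XE]]|_ [s [Gs Fs] <-]].
    exists s => //; split => //; move: Xp; rewrite XE => -[q Fq <-].
    by rewrite addrK.
  by split; [exists (p - s) => //; rewrite subrK|exists s].
apply: card_eq_trans Jk; apply: inj_card_eq => s s'.
rewrite !inE => -[Gs _] [Gs' _]; exact: translate_inj.
Qed.

End Tiling.

End RepresentationSpace.

Theorem theorem4p16 (R : realType) (n : nat) (A : 'M[rat]_n.+1)
    (eA : expanding A) (b_ge2 : (2 <= Zindex A^-1)%N)
    (muB : {sigma_finite_measure set (ZB_completion R eA b_ge2) -> \bar R})
    (D : {fset 'cV[rat]_n.+1}) (F : set (KA R eA b_ge2)) :
  normalized_haar muB ->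
  digit_system A D ->
  is_tile D F ->
  (0 < (lebesgueN R n.+1 \x muB) F)%E ->
  multiple_tiling (lebesgueN R n.+1 \x muB)%E F
    (@phi R n A eA b_ge2 @` [set x | Zspan A (val x)]).
Proof.
move=> [muB_shift muB1] hD [F0 cF hF] muF; rewrite ZB_integersE in muB1.
have hF' : @dilation R n A eA b_ge2 @` F =
    \bigcup_(x in [set x | val x \in D]) [set p + phi R eA b_ge2 x | p in F].
  rewrite -[RHS]hF; apply: eq_imagel => p _.
  by rewrite /mul_KA mul_completionE.
apply: (multiple_tiling_of_null_complement cF F0 hD hF' _ muF) => U oU U0 UG Uc.
apply: (null_complement (@lebesgueN_shift R n.+1) (@lebesgueN_box R n.+1) muB_shift muB1) => //.
exact: (index_gt0 F0 hD hF').
Qed.
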